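(* Let $K:\mathbb{R}^d\times\mathbb{R}^d\to\mathbb{R}$ be a kernel function which is shift-invariant (i.e. $K(x,y)=K(x-y)$, normalized so that $K(0)=1$) and analytic at the origin, with feature mapping $\varphi:\mathbb{R}^d\to\mathcal{H}$ into a Hilbert space $\mathcal{H}$. There are constants depending only on $K$ such that the following holds. For every $0<\delta\le\epsilon\le 2^{-16}$ and every $d,D\in\mathbb{N}$ with $D\ge\max\{\Theta(\epsilon^{-1}\log^3(1/\delta)),\Theta(\epsilon^{-2}\log(1/\delta))\}$, if $\pi:\mathbb{R}^d\to\mathbb{R}^D$ is the RFF mapping for $K$ with target dimension $D$, then for every $x,y\in\mathbb{R}^d$, \[\Pr\big[\,|\mathrm{dist}_\pi(x,y)-\mathrm{dist}_\varphi(x,y)|\le\epsilon\cdot\mathrm{dist}_\varphi(x,y)\,\big]\ge1-\delta.\]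
   Context: $K$ is analytic at the origin if there is $r>0$ such that $K$ (viewed as a function of $x-y\in\mathbb{R}^d$) is analytic on $\{x\in\mathbb{R}^d:\|x\|_1<r\}$. Let $p$ be the probability density on $\mathbb{R}^d$ (Bochner's theorem) with $K(x)=\int p(\omega)e^{\mathrm{i}\langle\omega,x\rangle}\,d\omega$. The RFF mapping with target dimension $D$ is $\pi(x)=\sqrt{1/D}\,(\sin\langle\omega_1,x\rangle,\cos\langle\omega_1,x\rangle,\dots,\sin\langle\omega_D,x\rangle,\cos\langle\omega_D,x\rangle)$ with $\omega_1,\dots,\omega_D$ i.i.d. of density $p$. $\mathrm{dist}_f(x,y)=\|f(x)-f(y)\|_2$; $\mathrm{dist}_\varphi(x,y)=\sqrt{2-2K(x-y)}$. The $\Theta(\cdot)$ in the lower bound for $D$ hides constants depending on $K$. *)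

(* Defs.v *)
From HB Require Import structures.
From mathcomp Require Import all_boot all_order all_algebra.
From mathcomp Require Import all_classical all_reals all_analysis.

Set Implicit Arguments.
Unset Strict Implicit.
Unset Printing Implicit Defensive.

Import Order.TTheory GRing.Theory Num.Theory.
Import numFieldNormedType.Exports.

Local Open Scope classical_set_scope.
Local Open Scope ring_scope.

Section Defs.
Variable R : realType.

(* Points of R^d are d-tuples of reals (with the product Borel sigma-algebra). *)

Definition vsub (d : nat) (x y : d.-tuple R) : d.-tuple R :=
  [tuple tnth x i - tnth y i | i < d].

Definition dotp (d : nat) (w x : d.-tuple R) : R :=
  \sum_(i < d) tnth w i * tnth x i.

Definition norm1 (d : nat) (x : d.-tuple R) : R := \sum_(i < d) `|tnth x i|.

(* Lebesgue integral on R^d, written as an iterated integral of the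
   one-dimensional Lebesgue integral (equal to the integral w.r.t. the
   d-dimensional Lebesgue measure by Tonelli/Fubini for the nonnegative or
   integrable functions to which it is applied below). *)
Fixpoint lebesgue_int (d : nat) : (d.-tuple R -> \bar R) -> \bar R :=
  match d return (d.-tuple R -> \bar R) -> \bar R with
  | 0 => fun f => f [tuple]
  | d'.+1 => fun f =>
      (\int[@lebesgue_measure R]_(x in [set: R])
         lebesgue_int (fun t : d'.-tuple R => f (cons_tuple x t)))%E
  end.

Definition pseries_partial (d : nat) (c : ('I_d -> nat) -> R)
    (a x : d.-tuple R) (g : R -> R) (N : nat) : R :=
  \sum_(al : {ffun 'I_d -> 'I_N.+1} | (\sum_(i < d) (al i : nat) <= N)%N)
     g (c (fun i => (al i : nat)) * \prod_(i < d) (tnth x i - tnth a i) ^+ al i).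

Definition analytic_on (d : nat) (f : d.-tuple R -> R) (U : set (d.-tuple R)) :=
  forall a, U a ->
    exists (c : ('I_d -> nat) -> R) (rho : R), 0 < rho /\
      forall x, (forall i, `|tnth x i - tnth a i| < rho) ->
        cvgn (pseries_partial c a x (fun z : R => `|z|)) /\
        pseries_partial c a x id @ \oo --> f x.

Definition analytic_at_origin (d : nat) (K : d.-tuple R -> R) :=
  exists r : R, 0 < r /\ analytic_on K [set x | norm1 x < r].

Definition prob_density (d : nat) (p : d.-tuple R -> R) :=
  measurable_fun [set: d.-tuple R] p /\ (forall w, 0 <= p w) /\
  lebesgue_int (fun w => (p w)%:E) = 1%E.

(* Bochner: K(x) = int p(w) e^{i<w,x>} dw  (real and imaginary parts) *)
Definition bochner_density (d : nat) (K p : d.-tuple R -> R) :=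
  prob_density p /\
  forall x, lebesgue_int (fun w => (p w * cos (dotp w x))%:E) = (K x)%:E /\
            lebesgue_int (fun w => (p w * sin (dotp w x))%:E) = 0%E.

(* The RFF mapping pi(x) in R^{2D}: coordinates indexed by (j, b) with
   b = true for sin<w_j,x> and b = false for cos<w_j,x>. *)
Definition rff (d D : nat) (w : 'I_D -> d.-tuple R) (x : d.-tuple R)
    (j : 'I_D) (b : bool) : R :=
  Num.sqrt (D%:R^-1) * (if b then sin (dotp (w j) x) else cos (dotp (w j) x)).

Definition dist_rff (d D : nat) (w : 'I_D -> d.-tuple R) (x y : d.-tuple R) : R :=
  Num.sqrt (\sum_(j < D) \sum_(b : bool) (rff w x j b - rff w y j b) ^+ 2).

Definition dist_phi (d : nat) (K : d.-tuple R -> R) (x y : d.-tuple R) : R :=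
  Num.sqrt (2 - 2 * K (vsub x y)).

Definition iid_density (dsp : measure_display) (Omega : measurableType dsp)
    (P : probability Omega R) (d D : nat) (p : d.-tuple R -> R)
    (w : 'I_D -> Omega -> d.-tuple R) :=
  (forall j, measurable_fun [set: Omega] (w j)) /\
  (forall j (A : set (d.-tuple R)), measurable A ->
     P (w j @^-1` A) = lebesgue_int (fun v => (\1_A v * p v)%:E)) /\
  (forall A : 'I_D -> set (d.-tuple R), (forall j, measurable (A j)) ->
     P [set t | forall j, A j (w j t)] =
     (\prod_(j < D) P (w j @^-1` A j))%E).

End Defs.

(* Main.v *)
Require Import Defs.
From HB Require Import structures.
From mathcomp Require Import all_boot all_order all_algebra.
From mathcomp Require Import all_classical all_reals all_analysis.
From mathcomp Require Import measurable_realfun simple_functions ring lra.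

Import Order.TTheory GRing.Theory Num.Theory.
Import numFieldNormedType.Exports.

Local Open Scope classical_set_scope.
Local Open Scope ring_scope.

(** Put [z = x - y], [X w = 1 - cos <w, z>] and [mu = E X = 1 - K z], so that
    [dist_phi ^ 2 = 2 mu] and [dist_rff ^ 2 = (2 / D) sum_j X (w_j)]; it suffices to
    bound the relative error of the empirical mean of [X].

    Comparing iterated second differences of [K] at the origin along the axes with
    those of its power series bounds all even moments of [w_i], hence
    [E exp (t (1 + |w|_1)) < oo] for some [t > 0].  As the law of [w] has a density,
    the mean over [j <= n] of [cos (j <w, z>)] has a small expectation for large [z];
    with [1 - cos (j a) <= j ^ 2 (1 - cos a)] this gives, for all [z],
    [X w <= C0 (1 + |w|_1) ^ 2 mu].  A Chernoff bound, applied for the upper tail to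
    [X] truncated at [1 + |w|_1 <= v] with [v] of order [log (D / delta)], then gives
    the concentration of the empirical mean. *)

(** The estimate has to be relative to [mu], uniformly in [z], although [mu] vanishes at [z = 0].
    The domination of [X] by [C0 (1 + |w|_1)^2 mu] supplies this: it turns an exponential moment of
    [|w|_1], which does not depend on [z], into [E X^2 <= C2 mu^2]. The Chernoff parameter can then
    be [theta / mu], and [mu] drops out of the exponent, which is about [D theta eps]. Two limits on
    [theta] produce the two conditions on [D]: [theta <= eps / (4 C2)], from the second moment,
    costs [eps^-2 log (1/delta)] samples; [theta <= 1 / (2 C0 v^2)], from the truncation, costs
    [eps^-1 v^2 log (1/delta)], which is the cubed logarithm once [v] is logarithmic. Two features
    of the definitions also shape the proof: [lebesgue_int] is a recursive expression and not a
    measure, and independence is given for events only. *)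

(** * Iterated Lebesgue integrals as integrals against a measure *)

(** Induction on [d] with the parameter space generalized: the outermost coordinate joins the
    parameter. [h] has no sign, so Tonelli is applied to the positive and negative parts of the
    inner integral. *)
Lemma measurable_lebesgue_int {R : realType} {d : nat} {dX : measure_display}
    {X : measurableType dX} (h : X * d.-tuple R -> \bar R) :
  measurable_fun setT h ->
  measurable_fun [set: X] (fun x => lebesgue_int (fun t => h (x, t))).
Proof.
elim: d dX X h => [|d IH] dX X h mh /=.
  by apply: (measurableT_comp mh); exact: measurable_pair2.
pose g (xu : X * R) := lebesgue_int (fun t => h (xu.1, cons_tuple xu.2 t)).
have mg : measurable_fun [set: X * R] g.
  apply: (IH _ _ (fun z : (X * R) * d.-tuple R => h (z.1.1, cons_tuple z.1.2 z.2))).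
  apply: (measurableT_comp mh); apply: measurable_fun_pair.
    exact: measurableT_comp measurable_fst measurable_fst.
  apply: measurable_cons => //.
  exact: measurableT_comp measurable_snd measurable_fst.
under eq_fun do rewrite integralE.
apply: emeasurable_funB.
- have mgp : measurable_fun setT (g^\+)%E by exact: measurable_funepos.
  have := measurable_fun_fubini_tonelli_F (m2 := @lebesgue_measure R) _ mgp (fun x => funepos_ge0 g x).
  congr measurable_fun; apply/funext => x; apply: eq_integral => u _.
  by rewrite !funeposE.
- have mgn : measurable_fun setT (g^\-)%E by exact: measurable_funeneg.
  have := measurable_fun_fubini_tonelli_F (m2 := @lebesgue_measure R) _ mgn (fun x => funeneg_ge0 g x).
  congr measurable_fun; apply/funext => x; apply: eq_integral => u _.
  by rewrite !funenegE.
Qed.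

Lemma sigma_finite_product_measure1 d1 d2 (T1 : measurableType d1)
    (T2 : measurableType d2) (R : realType)
    (m1 : {sigma_finite_measure set T1 -> \bar R})
    (m2 : {sigma_finite_measure set T2 -> \bar R}) :
  sigma_finite setT (m1 \x m2)%E.
Proof.
by case: (lebesgue_integral_fubini.measure_function_Measure_isSigmaFinite__to__measure_function_isSigmaFinite m1 m2).
Qed.

Section LebesgueTuple.
Context {R : realType} {d : nat}.

Definition tuple_of_pair (z : R * d.-tuple R) : d.+1.-tuple R :=
  [the d.+1.-tuple R of z.1 :: z.2].

Lemma measurable_tuple_of_pair : measurable_fun [set: R * d.-tuple R] tuple_of_pair.
Proof. by apply: measurable_cons. Qed.

HB.instance Definition _ :=
  @isMeasurableFun.Build _ _ (R * d.-tuple R)%type (d.+1.-tuple R) tuple_of_pair measurable_tuple_of_pair.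

Context (mu : {sigma_finite_measure set (d.-tuple R) -> \bar R}).

Let psi (w : d.+1.-tuple R) : R * d.-tuple R := (thead w, behead_tuple w).

Let measurable_psi : measurable_fun [set: d.+1.-tuple R] psi.
Proof.
apply: measurable_fun_pair; first exact: measurable_tnth.
apply/measurable_fun_tnthP => i.
rewrite (_ : _ \o _ = (fun w => tnth w (lift ord0 i))); first exact: measurable_tnth.
by apply/funext => w /=; rewrite tnth_behead; congr tnth; apply/val_inj; rewrite /= inordK// ltnS.
Qed.

Let psiK : cancel tuple_of_pair psi.
Proof. by case=> x t; rewrite /psi theadE; congr pair; apply/val_inj. Qed.

(** When [mu] is Lebesgue measure on [d]-tuples, this is Lebesgue measure on [d.+1]-tuples; the new
    coordinate comes first, as in the recursion of [lebesgue_int]. *)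
Definition cons_measure := pushforward (lebesgue_measure \x mu)%E tuple_of_pair.

HB.instance Definition _ := Measure.copy cons_measure
  (measure_function_pushforward__canonical__measure_function_Measure
    (lebesgue_measure \x mu)%E measurable_tuple_of_pair).

Let sigma_finite_cons_measure : sigma_finite setT cons_measure.
Proof.
have [F FT mF] : sigma_finite setT (@lebesgue_measure R \x mu)%E.
  exact: sigma_finite_product_measure1.
(* An exhaustion of the product is carried to tuples by the measurable inverse [psi] of
   [tuple_of_pair]. *)
exists (fun n => psi @^-1` F n).
  by rewrite -preimage_bigcup -FT preimage_setT.
move=> n; have [mFn Fn] := mF n; split.
  by rewrite -[X in measurable X]setTI; exact: measurable_psi.
rewrite /cons_measure /pushforward.
rewrite (_ : _ @^-1` _ = F n) //.
by apply/seteqP; split => z; rewrite /= psiK.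
Qed.

HB.instance Definition _ := @Measure_isSigmaFinite.Build _ _ _ cons_measure
  sigma_finite_cons_measure.

End LebesgueTuple.

Section ConsMeasureIntegral.
Context {R : realType} {d : nat} (mu : {sigma_finite_measure set (d.-tuple R) -> \bar R}).

Lemma ge0_integral_cons_measure (f : d.+1.-tuple R -> \bar R) :
  measurable_fun [set: d.+1.-tuple R] f -> (forall w, 0 <= f w)%E ->
  (\int[cons_measure mu]_w f w =
   \int[@lebesgue_measure R]_x \int[mu]_t f (cons_tuple x t))%E.
Proof.
move=> mf f0; rewrite /cons_measure ge0_integral_pushforward//; last exact: measurable_tuple_of_pair.
rewrite preimage_setT (fubini_tonelli1 (f \o _))//.
  by apply: (measurableT_comp mf); exact: measurable_tuple_of_pair.
by move=> z; exact: f0.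
Qed.

(** Fubini makes the sections integrable for almost every [x] only. This and the measurability of
    the partial integral are recorded because the induction on the dimension can rewrite the inner
    integral only at such [x]. *)
Lemma integral_cons_measure (f : d.+1.-tuple R -> \bar R) :
  (cons_measure mu).-integrable [set: d.+1.-tuple R] f ->
  [/\ {ae @lebesgue_measure R, forall x, mu.-integrable [set: d.-tuple R] (fun t => f (cons_tuple x t))},
   measurable_fun [set: R] (fun x => \int[mu]_t f (cons_tuple x t))%E
   & (\int[cons_measure mu]_w f w =
   \int[@lebesgue_measure R]_x \int[mu]_t f (cons_tuple x t))%E].
Proof.
move=> intf.
have intfphi : (@lebesgue_measure R \x mu)%E.-integrable setT (f \o tuple_of_pair).
  have mf := measurable_int _ intf.
  apply/integrableP; split.
    by apply: (measurableT_comp mf); exact: measurable_tuple_of_pair.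
  have /integrableP[_] := intf; rewrite /cons_measure ge0_integral_pushforward//.
    exact: measurable_tuple_of_pair.
  exact: measurableT_comp.
split.
- exact: (ae_integrable1 intfphi).
- exact: (measurable_fubini_F intfphi).
rewrite /cons_measure integral_pushforward//.
- by rewrite preimage_setT -(integral12_prod_meas1 intfphi).
- exact: measurable_tuple_of_pair.
- exact: measurable_int intf.
Qed.

End ConsMeasureIntegral.

(** The two clauses are Tonelli and Fubini. In the second, the inner iterated integral is identified
    only for almost every [x], so comparing the outer integrals also uses its measurability. *)
Lemma lebesgue_int_measure (R : realType) (d : nat) :
  exists mu : {sigma_finite_measure set (d.-tuple R) -> \bar R},
  (forall f : d.-tuple R -> \bar R, measurable_fun [set: d.-tuple R] f ->
     (forall w, 0 <= f w)%E -> lebesgue_int f = (\int[mu]_w f w)%E) /\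
  (forall f : d.-tuple R -> \bar R, mu.-integrable [set: d.-tuple R] f ->
     lebesgue_int f = (\int[mu]_w f w)%E).
Proof.
elim: d => [|d [mu [Hge0 Hint]]].
  exists [the {sigma_finite_measure set (0.-tuple R) -> \bar R} of dirac [tuple]].
  split=> f mf /= => [f0|]; rewrite integral_dirac ?diracT ?mul1e//.
  exact: measurable_int mf.
exists [the {sigma_finite_measure set (d.+1.-tuple R) -> \bar R} of cons_measure mu].
split=> f mf /= => [f0|].
  rewrite ge0_integral_cons_measure//; apply: eq_integral => x _.
  apply: Hge0 => //; apply: (measurableT_comp mf).
  by apply: measurable_cons => //; exact: measurable_cst.
have [aei mi ->] := integral_cons_measure _ _ mf.
apply: ae_eq_integral => //.
  apply: (@measurable_lebesgue_int R d _ R (fun z => f (cons_tuple z.1 z.2))).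
  apply: (measurableT_comp (measurable_int _ mf)).
  by apply: measurable_cons.
by near=> x => /= _; apply: Hint; near: x.
Unshelve. all: by end_near.
Qed.

(** * Real-valued integrals and bounded random variables *)

Lemma measurable_superlevel {dT : measure_display} {T : measurableType dT}
    {R : realType} (h : T -> R) (c : R) :
  measurable_fun setT h -> measurable [set x | c < h x].
Proof.
move=> mh; rewrite (_ : [set x | _] = setT `&` h @^-1` `]c, +oo[%classic).
  by apply: mh => //; exact: measurable_itv.
by apply/seteqP; split => x /=; rewrite in_itv/= andbT; [move=> ?; split|case].
Qed.

Section RintegralSum.
Context {dT : measure_display} {T : measurableType dT} {R : realType}.
Context (m : {measure set T -> \bar R}).

Lemma integrable_Rsum (I : Type) (s : seq I) (f : I -> T -> R) :
  (forall i, m.-integrable setT (EFin \o f i)) ->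
  m.-integrable setT (EFin \o (fun x => \sum_(i <- s) f i x)).
Proof.
move=> intf; rewrite (_ : _ \o _ = (fun x => \sum_(i <- s) (f i x)%:E)%E).
  by apply: integrable_sum => // i _; exact: intf.
by apply/funext => x /=; rewrite sumEFin.
Qed.

Lemma Rintegral_sum (I : Type) (s : seq I) (f : I -> T -> R) :
  (forall i, m.-integrable setT (EFin \o f i)) ->
  \int[m]_x (\sum_(i <- s) f i x) = \sum_(i <- s) \int[m]_x f i x.
Proof.
move=> intf; elim: s => [|i s IH].
  by under eq_Rintegral do rewrite big_nil; rewrite big_nil /Rintegral integral0.
under eq_Rintegral do rewrite big_cons.
by rewrite RintegralD// ?big_cons ?IH//; exact: integrable_Rsum.
Qed.

Lemma integrable_EFinZl (c : R) (f : T -> R) : m.-integrable setT (EFin \o f) ->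
  m.-integrable setT (EFin \o (fun x => c * f x)).
Proof.
move=> intf; rewrite (_ : _ \o _ = (fun x => c%:E * (f x)%:E)%E)//.
exact: integrableZl.
Qed.

Lemma integrable_EFinD (f g : T -> R) : m.-integrable setT (EFin \o f) ->
  m.-integrable setT (EFin \o g) -> m.-integrable setT (EFin \o (fun x => f x + g x)).
Proof.
move=> intf intg; rewrite (_ : _ \o _ = (fun x => (f x)%:E + (g x)%:E)%E)//.
by apply: integrableD.
Qed.

Lemma integrable_EFinB (f g : T -> R) : m.-integrable setT (EFin \o f) ->
  m.-integrable setT (EFin \o g) -> m.-integrable setT (EFin \o (fun x => f x - g x)).
Proof.
move=> intf intg; rewrite (_ : _ \o _ = (fun x => (f x)%:E - (g x)%:E)%E)//.
by apply: integrableB.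
Qed.

End RintegralSum.

Section BoundedExpectation.
Context {dT : measure_display} {T : measurableType dT} {R : realType}.
Context (Q : probability T R).

Lemma integrable_bounded (f : T -> R) (C : R) :
  measurable_fun setT f -> (forall x, `|f x| <= C) ->
  Q.-integrable setT (EFin \o f).
Proof.
move=> mf fC; apply: measurable_bounded_integrable => //.
  by apply: fin_num_fun_lty; exact: fin_num_measure.
by exists C; split; [exact: num_real | move=> y Cy x _; exact: le_trans (fC x) (ltW Cy)].
Qed.

Lemma Rintegral_indic (A : set T) : measurable A ->
  \int[Q]_x \1_A x = fine (Q A).
Proof. by move=> mA; rewrite /Rintegral integral_indic// setIT. Qed.

Lemma Rintegral_prob_cst (c : R) : \int[Q]_x c = c.
Proof. by rewrite Rintegral_cst//= probability_setT mulr1. Qed.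

End BoundedExpectation.

(** The sum counts the natural numbers below [a], that is, it rounds [a] up. Applied to [N f] it
    approximates [f] within [1 / N] by indicators of superlevel sets. *)
Lemma sum_lt_nat_bounds {R : realFieldType} (L : nat) (a : R) : 0 <= a <= L%:R ->
  a <= \sum_(k < L) (k%:R < a)%R%:R <= a + 1.
Proof.
elim: L => [|L IH] /andP[a0 aL]; first by rewrite big_ord0; lra.
rewrite big_ord_recr /=; have [aleL|Llta] := leP a L%:R.
  by rewrite addr0; apply: IH; rewrite a0.
rewrite (eq_bigr (fun=> 1)) => [|i _].
  rewrite sumr_const card_ord; move: aL; rewrite -natr1 => aL.
  rewrite -[_ *+ L]/(L%:R) -[true%:R]/(1 : R); apply/andP; split; lra.
by rewrite (le_lt_trans _ Llta)// ler_nat ltnW.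
Qed.

(** * Expectations of products over independent samples *)

Section IidProduct.
Context {R : realType} {dO dT : measure_display} {Omega : measurableType dO}
  {T : measurableType dT}.
Context (P : probability Omega R) (Q : probability T R) (D : nat)
  (w : 'I_D -> Omega -> T).
Hypothesis mw : forall j, measurable_fun setT (w j).
Hypothesis lawP : forall j A, measurable A -> P (w j @^-1` A) = Q A.
Hypothesis indepP : forall A : 'I_D -> set T, (forall j, measurable (A j)) ->
  P [set t | forall j, A j (w j t)] = (\prod_(j < D) P (w j @^-1` A j))%E.

(** The product of indicators is the indicator of the joint event, to which independence applies
    directly. *)
Let prod_indic_expectation (A : 'I_D -> set T) : (forall j, measurable (A j)) ->
  P.-integrable setT (EFin \o (fun t => \prod_(j < D) \1_(A j) (w j t))) /\
  \int[P]_t (\prod_(j < D) \1_(A j) (w j t)) = \prod_(j < D) fine (Q (A j)).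
Proof.
move=> mA.
have mI : measurable [set t | forall j, A j (w j t)].
  rewrite (_ : [set t | _] = \bigcap_(j in [set: 'I_D]) (w j @^-1` A j)).
    apply: fin_bigcap_measurable => // j _; rewrite -[X in measurable X]setTI; exact: mw.
  by apply/seteqP; split => t /= h j; [move=> _; exact: h|exact: h].
have indicE' t : \prod_(j < D) \1_(A j) (w j t) = \1_[set t | forall j, A j (w j t)] t :> R.
  rewrite [RHS]indicE; case: (pselect (forall j, A j (w j t))) => [h|h].
    by rewrite mem_set// big1// => j _; rewrite indicE mem_set.
  rewrite memNset//; have /existsNP[j hj] := h.
  by rewrite (bigD1 j)//= indicE memNset ?mul0r.
split.
  apply: (@integrable_bounded _ _ _ _ _ 1).
    by under eq_fun do rewrite indicE'; exact: measurable_indic.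
  by move=> t; rewrite indicE' indicE ger0_norm ?ler0n// lern1 leq_b1.
under eq_Rintegral do rewrite indicE'.
rewrite Rintegral_indic//= indepP//.
transitivity (fine (\prod_(j < D) (fine (Q (A j)))%:E)%E); last by rewrite prodEFin.
congr fine; apply: eq_bigr => j _; rewrite lawP// fineK//.
exact: fin_num_measure.
Qed.

(** For a step function [g] the product of sums expands into products of indicators, and its
    expectation is exactly [(E g)^D]. Nonnegativity makes the product monotone in its factors, so
    [f] is squeezed under [g], and [N] tends to infinity at the end. An inequality is what a
    Chernoff bound asks for. *)
Lemma iid_expectation_prod_le (f : T -> R) (M : R) :
  measurable_fun setT f -> (forall x, 0 <= f x <= M) ->
  \int[P]_t (\prod_(j < D) f (w j t)) <= (\int[Q]_x f x) ^+ D.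
Proof.
move=> mf fM.
have intf : Q.-integrable setT (EFin \o f).
  by apply: (@integrable_bounded _ _ _ _ _ M) => // x; have /andP[f0 fm] := fM x; rewrite ger0_norm.
have mprod : measurable_fun setT (fun t => \prod_(j < D) f (w j t)).
  by apply: measurable_prod => j _; exact: measurableT_comp.
(* [f <= g <= f + 1/N] for a combination [g] of indicators, to which independence of events applies. *)
have bound (N : nat) : (0 < N)%N -> \int[P]_t (\prod_(j < D) f (w j t)) <=
    (\int[Q]_x f x + N%:R^-1) ^+ D.
  move=> N0; have N0' : 0 < N%:R :> R by rewrite ltr0n.
  (* [L] exceeds every value of [N f], so the [L] superlevel sets recover [N f] rounded up. *)
  pose L := (Num.truncn (N%:R * M)).+1.
  pose A (k : 'I_L) := [set x | (k%:R < N%:R * f x)%R].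
  have mA k : measurable (A k).
    by apply: (measurable_superlevel (fun x => N%:R * f x)); exact: measurable_funM.
  pose g x : R := N%:R^-1 * \sum_(k < L) \1_(A k) x.
  have gE x : f x <= g x <= f x + N%:R^-1.
    have /sum_lt_nat_bounds : 0 <= N%:R * f x <= L%:R.
      have /andP[f0 fm] := fM x; rewrite mulr_ge0// ?ler0n//=.
      rewrite (le_trans _ (ltW (truncnS_gt _)))// ler_wpM2l// ltW//.
    rewrite (eq_bigr (fun k : 'I_L => \1_(A k) x)) => [|k _]; last first.
      rewrite indicE; congr (_%:R); congr nat_of_bool.
      by apply/idP/idP; rewrite inE.
    rewrite /g => /andP[h1 h2]; apply/andP; split.
      by rewrite mulrC ler_pdivlMr// mulrC.
    by rewrite mulrC ler_pdivrMr// mulrDl mulVf ?gt_eqF// mulrC.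
  have prodgE t : \prod_(j < D) g (w j t) = N%:R^-1 ^+ D *
      \sum_(k : {ffun 'I_D -> 'I_L}) \prod_(j < D) \1_(A (k j)) (w j t).
    by rewrite big_split/= prodr_const card_ord; congr (_ * _); rewrite bigA_distr_bigA.
  have intk (k : {ffun 'I_D -> 'I_L}) := prod_indic_expectation (fun j => A (k j)) (fun j => mA (k j)).
  have intS := integrable_Rsum P _ (index_enum _) _ (fun k => (intk k).1).
  have intg : P.-integrable setT (EFin \o (fun t => \prod_(j < D) g (w j t))).
    rewrite (_ : _ \o _ = (fun t => (N%:R^-1 ^+ D)%:E * (\sum_(k : {ffun 'I_D -> 'I_L}) \prod_(j < D) \1_(A (k j)) (w j t))%:E)%E).
      exact: integrableZl.
    by apply/funext => t /=; rewrite prodgE.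
  have intI k : Q.-integrable setT (EFin \o (\1_(A k) : T -> R)).
    apply: (@integrable_bounded _ _ _ _ _ 1); first exact: measurable_indic.
    by move=> t; rewrite indicE ger0_norm ?ler0n// lern1 leq_b1.
  have intgQ : Q.-integrable setT (EFin \o g).
    rewrite (_ : _ \o _ = (fun t => (N%:R^-1)%:E * (\sum_(k < L) \1_(A k) t)%:E)%E)//.
    by apply: integrableZl => //; exact: integrable_Rsum.
  have Eg : \int[P]_t (\prod_(j < D) g (w j t)) = (\int[Q]_x g x) ^+ D.
    under eq_Rintegral do rewrite prodgE.
    rewrite RintegralZl// Rintegral_sum; last by move=> k; exact: (intk k).1.
    under eq_bigr do rewrite (intk _).2.
    rewrite -(bigA_distr_bigA (fun _ k => fine (Q (A k))))/=.
    rewrite prodr_const card_ord -exprMn; congr (_ ^+ _).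
    rewrite /g RintegralZl//; last exact: integrable_Rsum.
    rewrite Rintegral_sum//; congr (_ * _); apply: eq_bigr => k _.
    by rewrite Rintegral_indic.
  apply: (@le_trans _ _ (\int[P]_t (\prod_(j < D) g (w j t)))).
    apply: le_Rintegral => //.
      apply: (@integrable_bounded _ _ _ _ _ (M ^+ D)) => // t.
      rewrite normr_prod -[D in _ ^+ D]card_ord -prodr_const ler_prod// => j _.
      by have /andP[f0 fm] := fM (w j t); rewrite normr_ge0 ger0_norm.
    move=> t _; apply: ler_prod => j _.
    by have /andP[f0 fm] := fM (w j t); have /andP[fg _] := gE (w j t); rewrite f0.
  rewrite Eg lerXn2r// ?nnegrE.
  - by apply: Rintegral_ge0 => x _; have /andP[fg _] := gE x; apply: le_trans fg; have /andP[] := fM x.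
  - apply: addr_ge0; last by rewrite invr_ge0 ltW.
    by apply: Rintegral_ge0 => x _; have /andP[] := fM x.
  rewrite -[X in _ + X](Rintegral_prob_cst Q) -RintegralD//; last first.
    by apply: (@integrable_bounded _ _ _ _ _ `|N%:R^-1|).
  apply: le_Rintegral => //; last by move=> x _; have /andP[] := gE x.
  apply: (@integrable_bounded _ _ _ _ _ (M + N%:R^-1)).
    by apply: measurable_funD.
  move=> x; have /andP[f0 fm] := fM x.
  by rewrite ger0_norm ?lerD2r// addr_ge0// invr_ge0 ltW.
have cv0 : \int[Q]_x f x + n.+1%:R^-1 @[n --> \oo] --> \int[Q]_x f x.
  rewrite -[X in _ --> X]addr0; apply: cvgD; first exact: cvg_cst.
  exact: cvg_harmonic.
have cv : (\int[Q]_x f x + n.+1%:R^-1) ^+ D @[n --> \oo] --> (\int[Q]_x f x) ^+ D.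
  exact: (cvg_comp _ _ cv0 (@exprn_continuous R D _)).
rewrite -(cvg_lim _ cv)//; apply: limr_ge; first by apply/cvg_ex; eexists; exact: cv.
by apply: nearW => n; exact: bound.
Qed.

End IidProduct.

(** * The sampling law and Bochner's formula *)

Section DensityProbability.
Context {dT : measure_display} {T : measurableType dT} {R : realType}.
Context (mu : {sigma_finite_measure set T -> \bar R}) (p : T -> R).
Hypothesis mp : measurable_fun setT p.
Hypothesis p0 : forall x, 0 <= p x.
Hypothesis p1 : (\int[mu]_x (p x)%:E)%E = 1%E.

Definition density_prob (A : set T) := (\int[mu]_(x in A) (p x)%:E)%E.

Let density0 : density_prob set0 = 0%E.
Proof. by rewrite /density_prob integral_set0. Qed.

Let density_ge0 A : (0 <= density_prob A)%E.
Proof. by rewrite /density_prob integral_ge0//= => x _; rewrite lee_fin. Qed.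

Let density_sigma_additive : semi_sigma_additive density_prob.
Proof.
move=> /= F mF tF mUF; rewrite /density_prob; apply: cvg_toP.
  apply: ereal_nondecreasing_is_cvgn => m n mn.
  by apply: lee_sum_nneg_natr => // k _ _; apply: integral_ge0 => /= x _; rewrite lee_fin.
rewrite ge0_integral_bigcup//=.
- exact/measurable_funTS/measurable_EFinP.
- by move=> x _; rewrite lee_fin.
Qed.

HB.instance Definition _ := isMeasure.Build _ _ _
  density_prob density0 density_ge0 density_sigma_additive.

Let density_setT : density_prob setT = 1%E.
Proof. exact: p1. Qed.

HB.instance Definition _ :=
  @Measure_isProbability.Build _ _ R density_prob density_setT.

Definition density_probability : probability T R := density_prob.

Let Q := density_probability.

Lemma integrable_density : mu.-integrable setT (EFin \o p).
Proof.
apply/integrableP; split; first exact/measurable_EFinP.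
by under eq_integral do rewrite /= ger0_norm//; rewrite p1 ltry.
Qed.

(** [Q] is dominated by [mu], and its Radon-Nikodym derivative has the same integral as [p] over
    every measurable set, hence equals [p] almost everywhere. *)
Lemma integral_density_prob (f : T -> R) : Q.-integrable setT (EFin \o f) ->
  (\int[Q]_x (f x)%:E = \int[mu]_x (f x * p x)%:E)%E.
Proof.
move=> intf.
have Qmu : Q `<< mu.
  apply/null_content_dominatesP => A mA A0; apply/eqP; rewrite eq_le measure_ge0 andbT.
  rewrite /Q/= /density_prob.
  rewrite null_set_integral//; exact/measurable_funTS/measurable_EFinP.
rewrite -(Radon_Nikodym_change_of_variables Qmu measurableT intf).
apply: ae_eq_integral => //.
- apply: emeasurable_funM; first exact: measurable_int intf.
  exact: measurable_int (Radon_Nikodym_integrable _).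
- apply/measurable_EFinP/measurable_funM => //.
  exact/measurable_EFinP/(measurable_int _ intf).
suff ae : ae_eq mu setT (Radon_Nikodym (charge_of_finite_measure Q) mu) (EFin \o p).
  exact: (ae_eqe_mul2l (EFin \o f) ae).
apply: integral_ae_eq => //.
- exact: Radon_Nikodym_integrable.
- exact/measurable_EFinP.
by move=> E _ mE; rewrite -Radon_Nikodym_integral.
Qed.

End DensityProbability.

Lemma measurable_dotp {R : realType} {d : nat} (z : d.-tuple R) :
  measurable_fun [set: d.-tuple R] (fun w => dotp w z).
Proof.
rewrite /dotp; apply: measurable_sum => i.
by apply: measurable_funM => //; exact: measurable_tnth.
Qed.

Lemma measurable_cos_dotp {R : realType} {d : nat} (z : d.-tuple R) :
  measurable_fun [set: d.-tuple R] (fun w => cos (dotp w z)).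
Proof.
have mcos : measurable_fun setT (@cos R).
  by apply: continuous_measurable_fun; exact: continuous_cos.
exact: (measurableT_comp mcos (measurable_dotp z)).
Qed.

Lemma normr_cos_le1 {R : realType} (x : R) : `|cos x| <= 1.
Proof. by rewrite ler_norml cos_geN1 cos_le1. Qed.

(** Collects what is used about the density: [Q] is the law of one frequency, and the last clause
    moves expectations to [mu], where integrals over boxes can be computed. *)
Lemma bochner_law {R : realType} {d : nat} (K p : d.-tuple R -> R) :
  bochner_density K p ->
  exists (mu : {sigma_finite_measure set (d.-tuple R) -> \bar R})
         (Q : probability (d.-tuple R) R),
  [/\ forall A, measurable A -> Q A = lebesgue_int (fun v => (\1_A v * p v)%:E),
      forall z, \int[Q]_w cos (dotp w z) = K z,
      forall f : d.-tuple R -> \bar R, mu.-integrable [set: d.-tuple R] f ->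
        lebesgue_int f = (\int[mu]_w f w)%E,
      forall f : d.-tuple R -> \bar R, measurable_fun [set: d.-tuple R] f ->
        (forall w, 0 <= f w)%E -> lebesgue_int f = (\int[mu]_w f w)%E &
      forall f : d.-tuple R -> R, Q.-integrable [set: d.-tuple R] (EFin \o f) ->
        (\int[Q]_x (f x)%:E = \int[mu]_x (f x * p x)%:E)%E].
Proof.
case=> -[mp [p0 p1]] Kcos.
have [mu [Hge0 Hint]] := lebesgue_int_measure R d.
have mup1 : (\int[mu]_x (p x)%:E)%E = 1%E.
  by rewrite -Hge0 => [//||w]; [exact/measurable_EFinP|rewrite lee_fin].
have intp := integrable_density mu p mp p0 mup1.
pose Q : probability (d.-tuple R) R := density_probability mu p mp p0 mup1.
exists mu, Q; split => //.
- move=> A mA; rewrite Hge0; last 2 first.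
  + apply/measurable_EFinP/measurable_funM => //; exact: measurable_indic.
  + by move=> w; rewrite lee_fin mulr_ge0// indicE ler0n.
  rewrite /Q/= /density_prob integral_mkcond; apply: eq_integral => w _.
  by rewrite epatch_indic/= EFinM muleC.
- move=> z; rewrite /Rintegral integral_density_prob//; last first.
    apply: (@integrable_bounded _ _ _ _ _ 1); first exact: measurable_cos_dotp.
    by move=> w; exact: normr_cos_le1.
  have [Kz _] := Kcos z; rewrite -[RHS]/(fine (K z)%:E) -Kz Hint; last first.
    apply: (le_integrable measurableT _ _ intp).
      by apply/measurable_EFinP/measurable_funM => //; exact: measurable_cos_dotp.
    move=> w _ /=; rewrite lee_fin normrM (ger0_norm (p0 w)) ler_piMr//.
    exact: normr_cos_le1.
  by congr fine; apply: eq_integral => w _; rewrite mulrC.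
- by move=> f intf; exact: integral_density_prob.
Qed.

(** * Integrals of cosines over boxes *)

Section BoxIntegral.
Context {R : realType}.
Local Notation leb := (@lebesgue_measure R).

Lemma integral_itv_derive (F f : R -> R) (a b : R) : a < b ->
  (forall x : R, is_derive x 1 F (f x)) -> continuous f ->
  (\int[leb]_(x in `[a, b]) (f x)%:E = (F b - F a)%:E)%E.
Proof.
move=> ab dF cf; rewrite EFinB; apply: continuous_FTC2 => //.
- exact: continuous_subspaceT.
- have cF x : {for x, continuous F}.
    by apply/differentiable_continuous/derivable1_diffP; exact: ex_derive.
  split=> [x _||]; first exact: ex_derive.
    by apply: cvg_at_right_filter; exact: cF.
  by apply: cvg_at_left_filter; exact: cF.
- by move=> x _; rewrite derive1E; exact: derive_val.
Qed.

Lemma normr_sin_le (u : R) : `|sin u| <= `|u|.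
Proof.
wlog u0 : u / 0 <= u.
  move=> h; have [/h//|u0] := leP 0 u.
  by rewrite -normrN -sinN -(normrN u) h// oppr_ge0 ltW.
have [c _] : exists2 c, c \in `[0, u] & sin u - sin 0 = cos c * (u - 0).
  apply: (@MVT_segment R sin cos) => //.
  by apply: continuous_subspaceT; exact: continuous_sin.
by rewrite sin0 !subr0 => ->; rewrite normrM ler_piMl ?normr_ge0//; exact: normr_cos_le1.
Qed.

(** The integral of [cos (x z)] over [[-W, W]]; the value at [z = 0] is the limit of the
    quotient. *)
Definition box_cos (W z : R) : R := if z == 0 then 2 * W else 2 * sin (W * z) / z.

Lemma integral_box_cos (W z b : R) : 0 < W ->
  (\int[leb]_(x in `[(- W)%R, W]) (cos (x * z + b))%:E = (box_cos W z * cos b)%:E)%E.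
Proof.
move=> W0; have WW : - W < W by lra.
rewrite /box_cos; case: eqVneq => [->|z0].
  under eq_integral do rewrite mulr0 add0r.
  have dF (x : R) : is_derive x 1 (fun x => x * cos b) (cos b).
    by apply: is_derive_eq; rewrite /GRing.scale/= mulr1 mulr0 add0r.
  rewrite (integral_itv_derive _ _ _ _ WW dF); last by move=> x; exact: cst_continuous.
  by congr EFin; ring.
have dF (x : R) : is_derive x 1 (fun x => sin (x * z + b) / z) (cos (x * z + b)).
  apply: is_derive_eq; rewrite /GRing.scale/= !(mulr0, addr0, add0r, mulr1).
  by field.
rewrite (integral_itv_derive _ _ _ _ WW dF); last first.
  move=> x; apply: continuous_comp; last exact: continuous_cos.
  by apply: continuousD; [apply: continuousM; [exact: id|exact: cst_continuous]|exact: cst_continuous].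
by congr EFin; rewrite mulNr !sinD cosN sinN; field.
Qed.

Lemma box_cos_le (W z : R) : 0 < W -> `|box_cos W z| <= 2 * W.
Proof.
move=> W0; rewrite /box_cos; case: eqVneq => [_|z0]; first by rewrite ger0_norm// mulr_ge0// ltW.
rewrite normrM normfV ler_pdivrMr ?normr_gt0// normrM ger0_norm// -mulrA ler_wpM2l//.
by rewrite (le_trans (normr_sin_le _))// normrM (ger0_norm (ltW W0)).
Qed.

Lemma box_cos_le_inv (W z : R) : z != 0 -> `|box_cos W z| <= 2 / `|z|.
Proof.
move=> z0; rewrite /box_cos (negbTE z0) normrM normfV ler_wpM2r ?invr_ge0//.
by rewrite normrM ger0_norm// ler_piMr// ler_norml sin_geN1 sin_le1.
Qed.

Definition box_indic {d : nat} (W : R) (w : d.-tuple R) : R :=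
  \prod_(i < d) \1_(`[- W, W]%classic : set R) (tnth w i).

Lemma dotp_cons {d : nat} (x : R) (t : d.-tuple R) (z : d.+1.-tuple R) :
  dotp (cons_tuple x t) z = x * thead z + dotp t (behead_tuple z).
Proof.
rewrite /dotp big_ord_recl (tnth_nth 0)/=; congr (_ + _).
apply: eq_bigr => i _; rewrite tnthS; congr (_ * _).
by rewrite tnth_behead; congr tnth; apply/val_inj; rewrite /= inordK// ltnS.
Qed.

(** The phase [b] and the factor [c] are there for the induction: fixing the first coordinate [x]
    adds [x * thead z] to the phase and multiplies [c] by an indicator. *)
Lemma lebesgue_int_box_cos (d : nat) (W : R) (c b : R) (z : d.-tuple R) : 0 < W ->
  lebesgue_int (fun w => (c * box_indic W w * cos (dotp w z + b))%:E) =
  (c * \prod_(i < d) box_cos W (tnth z i) * cos b)%:E.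
Proof.
move=> W0; elim: d c b z => [|d IH] c b z /=.
  by rewrite /box_indic /dotp !big_ord0 add0r.
transitivity (\int[leb]_(x in `[(- W)%R, W])
    ((c * \prod_(i < d) box_cos W (tnth (behead_tuple z) i))%:E *
     (cos (x * thead z + b))%:E))%E.
  rewrite [RHS]integral_mkcond; apply: eq_integral => x _.
  rewrite epatch_indic/= -EFinM.
  transitivity (lebesgue_int (fun t : d.-tuple R => ((c * \1_(`[- W, W]%classic : set R) x) *
      box_indic W t * cos (dotp t (behead_tuple z) + (x * thead z + b)))%:E)).
    congr lebesgue_int; apply/funext => t; congr EFin.
    rewrite dotp_cons /box_indic big_ord_recl (tnth_nth 0)/=.
    under [in LHS]eq_bigr do rewrite tnthS.
    by rewrite mulrA; congr (_ * cos _); ring.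
  by rewrite IH; congr EFin; ring.
rewrite integralZl//; last first.
  apply: continuous_compact_integrable; first exact: segment_compact.
  apply: continuous_subspaceT => x; apply: continuous_comp; last exact: continuous_cos.
  by apply: continuousD; [apply: continuousM; [exact: id|exact: cst_continuous]|exact: cst_continuous].
rewrite integral_box_cos// -EFinM [in RHS]big_ord_recl; congr EFin.
rewrite (eq_bigr (fun i => box_cos W (tnth z (lift ord0 i)))); first by rewrite /thead; ring.
by move=> i _; rewrite tnth_behead; congr (box_cos _ (tnth _ _)); apply/val_inj; rewrite /= inordK// ltnS.
Qed.

End BoxIntegral.

(** * Quadratic bounds for 1 - cos *)

Section CosineBounds.
Context {R : realType}.
Implicit Type x : R.

Lemma one_sub_cosE x : 1 - cos x = 2 * sin (x / 2) ^+ 2.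
Proof.
have -> : cos x = cos ((x / 2) *+ 2) by congr cos; rewrite -mulr_natr; field.
by rewrite cos_mulr2n cos2sin2; ring.
Qed.

Lemma one_sub_cos_le x : 1 - cos x <= x ^+ 2 / 2.
Proof.
rewrite one_sub_cosE; have := normr_sin_le (x / 2).
rewrite -(ler_sqr (normr_ge0 _) (normr_ge0 _))// !real_normK ?num_real// => h.
rewrite (le_trans (ler_wpM2l _ h))//; lra.
Qed.

(** The mean value theorem gives [sin (x / 2) = cos c * (x / 2)] with [cos c >= 1 / 2], and
    [2 (1/2)^2 (x/2)^2] is [x^2 / 8]. *)
Lemma one_sub_cos_ge x : `|x| <= 1 -> x ^+ 2 / 8 <= 1 - cos x.
Proof.
wlog x0 : x / 0 <= x.
  move=> h; have [/h//|x0] := leP 0 x.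
  by move=> x1; rewrite -sqrrN -cosN h ?normrN// oppr_ge0 ltW.
rewrite ger0_norm// => x1.
have [c cx] : exists2 c, c \in `[0, x / 2] & sin (x / 2) - sin 0 = cos c * (x / 2 - 0).
  apply: (@MVT_segment R sin cos) => //; first lra.
  by apply: continuous_subspaceT; exact: continuous_sin.
rewrite sin0 !subr0 one_sub_cosE => ->.
have /andP[c0 cx2] : 0 <= c <= x / 2 by move: cx; rewrite in_itv.
have c12 : 1 / 2 <= cos c.
  have := one_sub_cos_le c; have : c ^+ 2 <= 1 by rewrite expr_le1//; lra.
  by move=> *; lra.
rewrite exprMn; have : (1 / 2) ^+ 2 <= cos c ^+ 2 by rewrite ler_sqr ?nnegrE; lra.
have : 0 <= (x / 2) ^+ 2 by exact: sqr_ge0.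
by nra.
Qed.

Lemma one_sub_cos_itv x : 0 <= 1 - cos x <= 2.
Proof. by have := cos_le1 x; have := cos_geN1 x => *; apply/andP; split; lra. Qed.

End CosineBounds.

(** * Iterated second differences *)

Section SecondDifference.
Context {R : realType}.
Implicit Types (f g : R -> R) (s x : R).

(** Minus the usual central second difference: with this sign the function [cos (y u)] of [y] is
    multiplied by [2 - 2 cos (s u)], which is nonnegative. *)
Definition diff2 s f : R -> R := fun x => 2 * f x - f (x + s) - f (x - s).

(** The iterate at [x] reads [f] only at points within [n s] of [x], all inside the ball where [f_]
    converges. *)
Lemma cvg_iter_diff2 s n (f_ : nat -> R -> R) f (x rho : R) : 0 <= s ->
  (forall y, `|y| < rho -> f_ ^~ y @ \oo --> f y) -> `|x| + n%:R * s < rho ->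
  (fun N => iter n (diff2 s) (f_ N) x) @ \oo --> iter n (diff2 s) f x.
Proof.
move=> s0 cf; elim: n x => [|n IH] x.
  by rewrite mul0r addr0; exact: cf.
rewrite -natr1 mulrDl mul1r => xn /=; rewrite /diff2.
have ns0 : 0 <= n%:R * s by rewrite mulr_ge0.
have h1 : `|x| + n%:R * s < rho by lra.
have h2 : `|x + s| + n%:R * s < rho.
  by have := ler_normD x s; rewrite (ger0_norm s0) => ?; lra.
have h3 : `|x - s| + n%:R * s < rho.
  by have := ler_normB x s; rewrite (ger0_norm s0) => ?; lra.
apply: cvgB; [apply: cvgB|]; [|exact: IH|exact: IH].
by apply: cvgM; [exact: cvg_cst|exact: IH].
Qed.

Lemma poly_MVT (p : {poly R}) (a b M : R) : a <= b ->
  (forall y, a <= y <= b -> `|p^`().[y]| <= M) -> `|p.[b] - p.[a]| <= M * (b - a).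
Proof.
move=> ab pM.
have [c /itvP cab ->] : exists2 c, c \in `[a, b] & p.[b] - p.[a] = p^`().[c] * (b - a).
  apply: (@MVT_segment R (horner p) (horner p^`())) => //.
  by apply: continuous_subspaceT; exact: continuous_horner.
rewrite normrM (ger0_norm (_ : 0 <= b - a)) ?subr_ge0// ler_wpM2r ?subr_ge0//.
by apply: pM; rewrite !cab.
Qed.

(** The polynomial [h(y) = 2 p(x) - p(x + y) - p(x - y)] vanishes at 0, and its derivative is a
    difference of values of [p']. The mean value theorem is applied to [p'] and then to [h]. *)
Lemma horner_diff2_le (p : {poly R}) s x (M : R) : 0 <= s ->
  (forall y, `|y| <= `|x| + s -> `|p^`(2).[y]| <= M) ->
  `|diff2 s (horner p) x| <= 2 * s ^+ 2 * M.
Proof.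
move=> s0 pM.
pose h : {poly R} := 2 * p.[x] *: 1 - (p \Po ('X + x%:P)) - (p \Po (x%:P - 'X)).
have hE y : h.[y] = 2 * p.[x] - p.[x + y] - p.[x - y].
  rewrite /h !(hornerE, horner_comp).
  by congr (_ - _.[_] - _.[_]); ring.
have h'E y : h^`().[y] = - (p^`().[x + y] - p^`().[x - y]).
  rewrite /h !derivB deriv_comp deriv_comp !poly.derivE !(hornerE, horner_comp) [in RHS](addrC x y).
  ring.
have M0 : 0 <= M by apply: le_trans (pM x _); rewrite ?normr_ge0// lerDl.
have h'M y : 0 <= y <= s -> `|h^`().[y]| <= 2 * s * M.
  move=> /andP[y0 ys]; rewrite h'E normrN.
  have xy : x - y <= x + y by lra.
  apply: (le_trans (poly_MVT p^`() (x - y) (x + y) M xy _)).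
    move=> t /andP[t1 t2]; rewrite -/(derivn 2 p); apply: pM.
    have := ler_norm x; have := ler_norm (- x); rewrite normrN ler_norml => ? ?; apply/andP; split; lra.
  by rewrite mulrC ler_wpM2r//; lra.
have h0 : h.[0] = 0 by rewrite hE addr0 subr0; ring.
have := poly_MVT h 0 s (2 * s * M) s0 h'M.
rewrite h0 subr0 hE subr0 /diff2 => hh; apply: (le_trans hh).
by rewrite expr2; lra.
Qed.

(** Second differences commute with derivatives, so the second difference [q] of [p] is a polynomial
    to which the induction hypothesis applies. Each difference costs two derivatives and widens the
    interval by [s]. *)
Lemma horner_iter_diff2_le n (p : {poly R}) s x (M : R) : 0 <= s ->
  (forall y, `|y| <= `|x| + n%:R * s -> `|p^`(n.*2).[y]| <= M) ->
  `|iter n (diff2 s) (horner p) x| <= (2 * s ^+ 2) ^+ n * M.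
Proof.
move=> s0; elim: n p M x => [|n IH] p M x pM.
  by rewrite expr0 mul1r; apply: pM; rewrite mul0r addr0.
pose q : {poly R} := 2 *: p - (p \Po ('X + s%:P)) - (p \Po ('X - s%:P)).
have qE k y : q^`(k).[y] = diff2 s (horner p^`(k)) y.
    have comp_derivn (c : R) : (p \Po ('X + c%:P))^`(k) = (p^`(k) \Po ('X + c%:P)).
    elim: k => // k IHk.
    by rewrite derivnS IHk deriv_comp derivD derivX derivC addr0 mulr1.
  rewrite /q !derivnB derivnZ -[- s%:P]polyCN !comp_derivn /diff2.
  by rewrite !(hornerE, horner_comp).
rewrite iterSr (_ : diff2 s (horner p) = horner q); last first.
  by apply/funext => y; rewrite -[p]/(p^`(0)) -qE.
rewrite exprSr -mulrA; apply: IH => y yn; rewrite qE.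
apply: horner_diff2_le => // t ty; have -> : (p^`(n.*2))^`(2) = p^`(n.+1.*2) by rewrite doubleS.
apply: pM.
apply: (le_trans ty); rewrite -natr1; lra.
Qed.

End SecondDifference.

(** The falling factorial [(k + i) ^_ k] is at most [k! 2^(k + i)], and for [|y| <= s0 / 4] the sum
    over [i] is dominated by a geometric one of ratio [2 / 4]. The bound is uniform in [N], so it
    survives the passage from partial sums to the limit. *)
Lemma derivn_poly_bound {R : realType} (a : nat -> R) (C s0 : R) (N k : nat) (y : R) :
  0 < s0 -> (forall m, `|a m| * s0 ^+ m <= C) -> `|y| <= s0 / 4 ->
  `|(\poly_(m < N) a m)^`(k).[y]| <= 2 * C * k`!%:R * (2 / s0) ^+ k.
Proof.
move=> s00 aC ys.
have C0 : 0 <= C by apply: le_trans (aC 0%N); rewrite mulr_ge0.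
rewrite (@horner_coef_wide _ N); last first.
  apply/leq_sizeP => j Nj; rewrite coef_derivn coef_poly ltnNge.
  by rewrite (leq_trans Nj (leq_addl _ _)) mul0rn.
apply: (le_trans (ler_norm_sum _ _ _)).
have q0 : 0 <= 2 / s0 by rewrite divr_ge0// ltW.
apply: (@le_trans _ _ (\sum_(i < N) C * k`!%:R * (2 / s0) ^+ k * (1 / 2) ^+ i)).
  apply: ler_sum => i _; rewrite coef_derivn coef_poly normrM normrX.
  case: ifP => _; last first.
    by rewrite mul0rn normr0 mul0r !mulr_ge0// exprn_ge0.
  have aki : `|a (k + i)%N| <= C / s0 ^+ (k + i) by rewrite ler_pdivlMr// exprn_gt0.
  have ff : ((k + i) ^_ k)%:R <= k`!%:R * 2 ^+ (k + i) :> R.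
    rewrite -bin_ffact natrM mulrC ler_wpM2l// -natrX ler_nat.
    rewrite -[2%N]/(1 + 1)%N Pascal (bigD1 (inord k : 'I_(k + i).+1))//=.
    by rewrite inordK ?ltnS ?leq_addr// !exp1n !muln1 leq_addr.
  rewrite normrMn -[_ *+ ((k + i) ^_ k)]mulr_natr.
  apply: (@le_trans _ _ (C / s0 ^+ (k + i) * (k`!%:R * 2 ^+ (k + i)) * (s0 / 4) ^+ i)).
    have yi : `|y| ^+ i <= (s0 / 4) ^+ i by rewrite lerXn2r// nnegrE divr_ge0// ltW.
    have af := ler_pM (normr_ge0 _) (ler0n _ _) aki ff.
    by apply: (ler_pM _ _ af yi); rewrite ?mulr_ge0 ?exprn_ge0.
  rewrite le_eqVlt; apply/orP; left; apply/eqP.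
  rewrite !exprD -[4]/((2 * 2)%:R) natrM !exprMn !exprVn exprMn expr1n.
  by field; rewrite ?expf_neq0 ?gt_eqF.
rewrite -mulr_sumr.
have geo : \sum_(i < N) (1 / 2) ^+ i <= 2 :> R.
  suff -> : \sum_(i < N) (1 / 2) ^+ i = 2 - 2 * (1 / 2) ^+ N :> R.
    by rewrite gerBl mulr_ge0// exprn_ge0//; lra.
  elim: N => [|N IH]; first by rewrite big_ord0 expr0 mulr1 subrr.
  by rewrite big_ord_recr/= IH exprS; field.
have -> : 2 * C * k`!%:R * (2 / s0) ^+ k = C * k`!%:R * (2 / s0) ^+ k * 2 by ring.
by apply: ler_wpM2l => //; rewrite !mulr_ge0// exprn_ge0.
Qed.

(** The odd terms cancel; these are the partial sums of the hyperbolic cosine. *)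
Lemma exp_coeff_even_sum {R : realType} (v : R) (M : nat) :
  (series (exp_coeff v) M.*2 + series (exp_coeff (- v)) M.*2) / 2 =
  \sum_(n < M) v ^+ n.*2 / (n.*2)`!%:R.
Proof.
elim: M => [|M IH]; first by rewrite /series/= !big_geq// big_ord0 addr0 mul0r.
rewrite big_ord_recr/= -IH doubleS /series/= !big_nat_recr//= /exp_coeff/=.
have e1 : (- v) ^+ M.*2 = v ^+ M.*2 by rewrite -mul2n exprM sqrrN -exprM.
have e2 : (- v) ^+ (M.*2).+1 = - v ^+ (M.*2).+1 by rewrite exprS e1 mulNr -exprS.
rewrite e1 e2 mulNr; lra.
Qed.

(** * Exponential moments from analyticity *)

Section ExponentialMoment.
Context {dT : measure_display} {T : measurableType dT} {R : realType}.
Context (Q : probability T R) (u : T -> R).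
Hypothesis mu : measurable_fun setT u.

Let integrable_cos_pow s n x : Q.-integrable setT
  (EFin \o (fun w => (2 - 2 * cos (s * u w)) ^+ n * cos (x * u w))).
Proof.
have mcos c : measurable_fun setT (fun w => cos (c * u w)).
  have mcos : measurable_fun setT (@cos R).
    by apply: continuous_measurable_fun; exact: continuous_cos.
  by apply: (measurableT_comp mcos); exact: measurable_funM.
apply: (@integrable_bounded _ _ _ _ _ (4 ^+ n)).
  apply: measurable_funM => //; apply: measurable_funX.
  by apply: measurable_funB => //; exact: measurable_funM.
move=> w; rewrite normrM -[4 ^+ n]mulr1 ler_pM ?normr_ge0 ?normr_cos_le1//.
have /andP[? ?] := one_sub_cos_itv (s * u w).
by rewrite normrX lerXn2r ?nnegrE// ler_norml; apply/andP; split; lra.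
Qed.

Let iter_diff2_expectation s n x :
  iter n (diff2 s) (fun y => \int[Q]_w cos (y * u w)) x =
  \int[Q]_w ((2 - 2 * cos (s * u w)) ^+ n * cos (x * u w)).
Proof.
elim: n x => [|n IH] x.
  by apply: eq_Rintegral => w _; rewrite expr0 mul1r.
have int2 y : Q.-integrable setT
    (EFin \o (fun w => 2 * ((2 - 2 * cos (s * u w)) ^+ n * cos (y * u w)))).
  exact: integrable_EFinZl.
rewrite iterS /diff2 !IH -RintegralZl// -RintegralB// -RintegralB//.
  by apply: eq_Rintegral => w _; rewrite !mulrDl !mulNr cosD cosB exprS; ring.
exact: integrable_EFinB.
Qed.

(** Differencing [n] times at 0 gives [E (2 - 2 cos (s u))^n], which the power series bounds by a
    multiple of [s^(2n)]; for small [s] it is at least [(s^2 / 4)^n] times the expectation of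
    [u^(2n)] over [|u| <= N]. The powers of [s] cancel, leaving the moment bound
    [2 C (2n)! (32 / s0^2)^n]. The cut at [N] supplies integrability before any moment is known to
    be finite. *)
Lemma exponential_moment (a : nat -> R) (rho : R) : 0 < rho ->
  (forall s, `|s| < rho ->
    series (fun m => a m * s ^+ m) @ \oo --> \int[Q]_w cos (s * u w)) ->
  (\int[Q]_w (expR (rho / 16 * `|u w|))%:E < +oo)%E.
Proof.
(* A point inside the disc of convergence: the terms [a m * s0 ^+ m] of a convergent series are
   bounded, which gives [C]. *)
move=> rho0 cvga; pose s0 := rho / 2.
have s00 : 0 < s0 by rewrite divr_gt0.
have [C aC] : exists C, forall m, `|a m| * s0 ^+ m <= C.
  have /cvga cv : `|s0| < rho by rewrite gtr0_norm// /s0; lra.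
  have /cvg_series_cvg_0 cv0 : cvgn (series (fun m => a m * s0 ^+ m)).
    by apply/cvg_ex; eexists; exact: cv.
  have /cvg_seq_bounded[M [_ hM]] : cvgn (fun m => a m * s0 ^+ m).
    by apply/cvg_ex; eexists; exact: cv0.
  have M1 : M < M + 1 by rewrite ltrDl.
  exists (M + 1) => m; have : `|a m * s0 ^+ m| <= M + 1 by exact: hM (M + 1) M1 m I.
  by rewrite normrM normrX (gtr0_norm s00).
have C0 : 0 <= C by apply: le_trans (aC 0%N); rewrite mulr_ge0.
have Ecos n s : 0 <= s -> n%:R * s <= s0 / 4 ->
    \int[Q]_w (2 - 2 * cos (s * u w)) ^+ n <=
    (2 * s ^+ 2) ^+ n * (2 * C * (n.*2)`!%:R * (2 / s0) ^+ n.*2).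
  move=> s_ge0 ns.
  have -> : \int[Q]_w (2 - 2 * cos (s * u w)) ^+ n =
      iter n (diff2 s) (fun y => \int[Q]_w cos (y * u w)) 0.
    rewrite iter_diff2_expectation; apply: eq_Rintegral => w _.
    by rewrite mul0r cos0 mulr1.
  have cv : (fun N => iter n (diff2 s) (horner (\poly_(m < N) a m)) 0) @ \oo -->
      iter n (diff2 s) (fun y => \int[Q]_w cos (y * u w)) 0.
    apply: (cvg_iter_diff2 _ _ _ _ _ rho) => // [y yrho|].
      rewrite (_ : (fun N => _) = series (fun m => a m * y ^+ m)); first exact: cvga.
      by apply/funext => N; rewrite horner_poly /series/= big_mkord.
    by rewrite normr0 add0r (le_lt_trans ns)// /s0; lra.
  rewrite -(cvg_lim _ cv)//; apply: limr_le; first by apply/cvg_ex; eexists; exact: cv.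
  apply: nearW => N; apply: (le_trans (ler_norm _)).
  apply: horner_iter_diff2_le => // y; rewrite normr0 add0r => yn.
  by apply: derivn_poly_bound => //; exact: le_trans yn ns.
pose A (N : nat) := [set w | `|u w| <= N%:R].
have mA N : measurable (A N).
  rewrite (_ : A N = ~` [set w | N%:R < `|u w|]).
    by apply: measurableC; apply: measurable_superlevel; exact: measurableT_comp.
  by apply/seteqP; split => w /=; rewrite /A/= leNgt => /negP.
have mX k : measurable_fun setT (fun w => u w ^+ k) by exact: measurable_funX.
have intpow N k : Q.-integrable setT (EFin \o (fun w => u w ^+ k * \1_(A N) w)).
  apply: (@integrable_bounded _ _ _ _ _ (N%:R ^+ k)).
    by apply: measurable_funM => //; exact: measurable_indic.
  move=> w; rewrite indicE; have [wA|wA] := boolP (w \in A N).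
    by rewrite mulr1 normrX lerXn2r ?nnegrE//; move: wA; rewrite inE.
  by rewrite mulr0 normr0 exprn_ge0.
have Epow N n : \int[Q]_w (u w ^+ n.*2 * \1_(A N) w) <= 2 * C * (n.*2)`!%:R * (32 / s0 ^+ 2) ^+ n.
  (* The first entry makes [|s u| <= 1] on [A N], as the quadratic lower bound for [1 - cos]
     requires; the second keeps all evaluation points within [s0 / 4], as the derivative bound
     requires. *)
  pose s := Num.min (N.+1%:R^-1) (s0 / 4 / n.+1%:R).
  have s_gt0 : 0 < s by rewrite lt_min invr_gt0 ltr0n/= !divr_gt0// ltr0n.
  have ns : n%:R * s <= s0 / 4.
    apply: (@le_trans _ _ (n.+1%:R * s)); first by rewrite ler_wpM2r ?ler_nat// ltW.
    by rewrite mulrC -ler_pdivlMr ?ltr0n// ge_min lexx orbT.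
  have sN w : A N w -> `|s * u w| <= 1.
    rewrite /A/= => uN; rewrite normrM gtr0_norm//.
    apply: (@le_trans _ _ (N.+1%:R^-1 * N.+1%:R)); last by rewrite mulVf ?pnatr_eq0.
    apply: ler_pM => //; [exact: ltW|by rewrite ge_min lexx|].
    by rewrite (le_trans uN)// ler_nat.
  have h : (s ^+ 2 / 4) ^+ n * \int[Q]_w (u w ^+ n.*2 * \1_(A N) w) <=
      (2 * s ^+ 2) ^+ n * (2 * C * (n.*2)`!%:R * (2 / s0) ^+ n.*2).
    apply: le_trans (Ecos n s (ltW s_gt0) ns).
    rewrite -RintegralZl//; apply: le_Rintegral => //.
    - exact: integrable_EFinZl.
    - have := integrable_cos_pow s n 0; congr (Q.-integrable _ _); apply/funext => w /=.
      by rewrite mul0r cos0 mulr1.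
    move=> w _; have /andP[? ?] := one_sub_cos_itv (s * u w).
    rewrite indicE; have [wA|wA] := boolP (w \in A N); last first.
      by rewrite !mulr0 exprn_ge0//; lra.
    rewrite mulr1 -mul2n exprM -exprMn.
    have a1 : 0 <= s ^+ 2 / 4 * u w ^+ 2 by rewrite mulr_ge0 ?divr_ge0 ?sqr_ge0.
    have a2 : s ^+ 2 / 4 * u w ^+ 2 <= 2 - 2 * cos (s * u w).
      by have := one_sub_cos_ge (s * u w) (sN w (set_mem wA)); rewrite exprMn => ?; lra.
    by apply: lerXn2r; rewrite ?nnegrE//; lra.
  have s2n : 0 < (s ^+ 2 / 4) ^+ n by rewrite exprn_gt0// divr_gt0// exprn_gt0.
  rewrite -(ler_pM2l s2n); apply: (le_trans h); rewrite le_eqVlt; apply/orP; left; apply/eqP.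
  rewrite -mul2n exprM mulrCA [RHS]mulrCA -exprMn -exprMn; congr (_ * _ ^+ _).
  by field; rewrite gt_eqF.
(* For [t = s0 / 8] the ratio [t^2 * 32 / s0^2] is [1 / 2], so the moment bounds sum to at most
   [4 C]. *)
pose t := rho / 16.
have ts0 : t = s0 / 8 by rewrite /t /s0; field.
(* Degree and cut-off grow together, so [g N] increases pointwise to [cosh (t u)] and monotone
   convergence applies. *)
pose g N w := \sum_(n < N) t ^+ n.*2 / (n.*2)`!%:R * (u w ^+ n.*2 * \1_(A N) w).
have intgn N (n : 'I_N) : Q.-integrable setT (EFin \o (fun w => t ^+ n.*2 / (n.*2)`!%:R * (u w ^+ n.*2 * \1_(A N) w))).
  exact: integrable_EFinZl.
have intg N : Q.-integrable setT (EFin \o g N) by exact: integrable_Rsum.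
have Eg N : \int[Q]_w g N w <= 4 * C.
  rewrite Rintegral_sum//.
  apply: (@le_trans _ _ (\sum_(n < N) 2 * C * (1 / 2) ^+ n)).
    apply: ler_sum => n _; rewrite RintegralZl//.
    have c0 : 0 <= t ^+ n.*2 / (n.*2)`!%:R by rewrite divr_ge0// exprn_ge0// divr_ge0// ltW.
    apply: (le_trans (ler_wpM2l c0 (Epow N n))).
    have f0 : (n.*2)`!%:R != 0 :> R by rewrite pnatr_eq0 -lt0n fact_gt0.
    rewrite le_eqVlt; apply/orP; left; apply/eqP.
    transitivity (2 * C * ((t ^+ 2) ^+ n * (32 / s0 ^+ 2) ^+ n)); last first.
      by rewrite -exprMn ts0; congr (_ * _ ^+ _); field; rewrite gt_eqF.
    by rewrite -exprM mul2n; field.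
  rewrite -mulr_sumr.
  suff -> : \sum_(i < N) (1 / 2) ^+ i = 2 - 2 * (1 / 2) ^+ N :> R.
    have : 0 <= C * (1 / 2) ^+ N by rewrite mulr_ge0// exprn_ge0//; lra.
    by nra.
  elim: N => [|N IH]; first by rewrite big_ord0 expr0 mulr1 subrr.
  by rewrite big_ord_recr/= IH exprS; field.
have cvg_g w : (g N w)%:E @[N --> \oo] --> ((expR (t * u w) + expR (- (t * u w))) / 2)%:E.
  apply/cvg_EFin; first by apply: nearW.
  pose v := t * u w.
  have cvE (x : R) : series (exp_coeff x) n.*2 @[n --> \oo] --> expR x.
    apply: (cvg_comp (fun n => n.*2) (series (exp_coeff x))); last exact: is_cvg_series_exp_coeff.
    by apply/cvgnyPge => m; near=> n; rewrite -addnn (leq_trans _ (leq_addr _ _))//; near: n; exact: nbhs_infty_ge.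
  have cv2 : (series (exp_coeff v) n.*2 + series (exp_coeff (- v)) n.*2) / 2 @[n --> \oo] -->
     (expR v + expR (- v)) / 2.
    by apply: cvgM; [apply: cvgD; exact: cvE|exact: cvg_cst].
  apply: cvg_trans cv2; apply: near_eq_cvg; near=> N.
  have wA : A N w by rewrite /A/=; near: N; exact: nbhs_infty_ger.
  rewrite exp_coeff_even_sum /g; apply: eq_bigr => n _.
  by rewrite indicE mem_set// mulr1 /v exprMn mulrAC.
have c0 n w : 0 <= t ^+ n.*2 / (n.*2)`!%:R * u w ^+ n.*2.
  by rewrite -mul2n !exprM !mulr_ge0// ?invr_ge0// exprn_ge0// sqr_ge0.
have g0 N w : 0 <= g N w.
  by apply: sumr_ge0 => n _; rewrite mulrA mulr_ge0// indicE ler0n.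
have nd w : {homo (fun N => (g N w)%:E) : N M / (N <= M)%N >-> (N <= M)%E}.
  move=> N M NM; rewrite lee_fin /g.
  rewrite (big_ord_widen M (fun n => t ^+ n.*2 / (n.*2)`!%:R * (u w ^+ n.*2 * \1_(A N) w)) NM).
  rewrite big_mkcond/=; apply: ler_sum => n _; rewrite !mulrA.
  case: ifP => _; last by rewrite mulr_ge0// indicE ler0n.
  rewrite ler_wpM2l// !indicE ler_nat; case: (boolP (w \in A N)) => // /set_mem wA.
  by rewrite mem_set//= /A/= (le_trans wA)// ler_nat.
have mg N : measurable_fun setT (EFin \o g N) by exact: measurable_int (intg N).
pose h w := (expR (t * u w) + expR (- (t * u w))) / 2.
have Eh : (\int[Q]_w (h w)%:E <= (4 * C)%:E)%E.
  have -> : (\int[Q]_w (h w)%:E = \int[Q]_w limn (fun N => (g N w)%:E))%E.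
    by apply: eq_integral => w _; rewrite (cvg_lim _ (cvg_g w)).
  have g0' N w : [set: T] w -> (0 <= (g N w)%:E)%E by rewrite lee_fin.
  have nd' w : [set: T] w -> nondecreasing_seq (fun N => (g N w)%:E) by move=> _; exact: nd.
  rewrite (monotone_convergence Q measurableT mg g0' nd').
  apply: lime_le.
    apply: ereal_nondecreasing_is_cvgn => N M NM; apply: ge0_le_integral => // w _; [by rewrite lee_fin..|exact: nd].
  apply: nearW => N; rewrite -[leLHS]fineK; first by rewrite lee_fin; exact: Eg.
  exact: integrable_fin_num (intg N).
have mh : measurable_fun setT h.
  apply: measurable_funM => //; apply: measurable_funD.
    by apply: measurableT_comp => //; exact: measurable_funM.
  by apply: measurableT_comp => //; apply: measurable_funN; exact: measurable_funM.
(* [expR (t |u|)] is at most twice the hyperbolic cosine [h]. *)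
apply: (@le_lt_trans _ _ (\int[Q]_w (2%:E * (h w)%:E))%E).
  have me : measurable_fun setT (fun w => (expR (t * `|u w|))%:E).
    apply/measurable_EFinP; apply: measurableT_comp => //; apply: measurable_funM => //.
    exact: measurableT_comp.
  have m2 : measurable_fun setT (fun w => 2%:E * (h w)%:E)%E.
    by apply/measurable_EFinP; exact: measurable_funM.
  apply: ge0_le_integral => // w _; rewrite -?EFinM lee_fin ?expR_ge0//.
  rewrite /h -/t.
  have [u0|u0] := leP 0 (u w).
    by rewrite ger0_norm//; have := expR_ge0 (- (t * u w)) => ?; lra.
  by rewrite ltr0_norm// mulrN; have := expR_ge0 (t * u w) => ?; lra.
rewrite ge0_integralZl//; last first.
- by move=> w _; rewrite lee_fin divr_ge0// addr_ge0 ?expR_ge0.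
- exact/measurable_EFinP.
apply: (@le_lt_trans _ _ (2%:E * (4 * C)%:E)%E); last by rewrite -EFinM ltry.
by apply: lee_wpmul2l.
Unshelve. all: by end_near.
Qed.

End ExponentialMoment.

(** * Mean square of averaged cosines on a box *)

Section BoxMeanSquare.
Context {R : realType} {d : nat} (mu : {sigma_finite_measure set (d.-tuple R) -> \bar R}).
Hypothesis Hint : forall f : d.-tuple R -> \bar R, mu.-integrable [set: d.-tuple R] f ->
  lebesgue_int f = (\int[mu]_w f w)%E.
Hypothesis Hge0 : forall f : d.-tuple R -> \bar R, measurable_fun [set: d.-tuple R] f ->
  (forall w, 0 <= f w)%E -> lebesgue_int f = (\int[mu]_w f w)%E.
Context (W : R) (W1 : 1 <= W).

Let W0 : 0 < W. Proof. exact: lt_le_trans W1. Qed.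

Lemma box_indic_itv (w : d.-tuple R) : 0 <= box_indic W w <= 1.
Proof.
rewrite /box_indic prodr_ge0 => [|i _]; last by rewrite indicE ler0n.
rewrite -[leRHS](expr1n _ #|'I_d|) -prodr_const ler_prod// => i _.
by rewrite indicE ler0n lern1 leq_b1.
Qed.

Lemma measurable_box_indic : measurable_fun [set: d.-tuple R] (@box_indic R d W).
Proof.
apply: measurable_prod => i _.
apply: (measurableT_comp (measurable_indic (measurable_itv `[- W, W]))).
exact: measurable_tnth.
Qed.

Lemma dotp_scale (c : R) (w z : d.-tuple R) :
  dotp w [tuple c * tnth z i | i < d] = c * dotp w z.
Proof. by rewrite /dotp mulr_sumr; apply: eq_bigr => i _; rewrite tnth_mktuple mulrCA. Qed.

Lemma integrable_box (f : d.-tuple R -> R) : measurable_fun [set: d.-tuple R] f ->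
  (forall w, `|f w| <= 1) ->
  mu.-integrable [set: d.-tuple R] (EFin \o (fun w => box_indic W w * f w)).
Proof.
move=> mf f1.
have b0 w : 0 <= @box_indic R d W w by case/andP: (box_indic_itv w).
have mb : measurable_fun [set: d.-tuple R] (EFin \o @box_indic R d W).
  by apply/measurable_EFinP; exact: measurable_box_indic.
have intb : mu.-integrable [set: d.-tuple R] (EFin \o (@box_indic R d W)).
  apply/integrableP; split => //.
  under eq_integral do rewrite /= ger0_norm//.
  rewrite -Hge0//.
  (* Frequency zero in the cosine formula gives the volume of the box. *)
  have -> : lebesgue_int (EFin \o @box_indic R d W) =
      lebesgue_int (fun w : d.-tuple R => (1 * box_indic W w * cos (dotp w [tuple 0 | i < d] + 0))%:E).
    congr lebesgue_int; apply/funext => w /=; congr EFin.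
    rewrite /dotp big1 ?addr0 ?cos0 ?mul1r ?mulr1// => i _.
    by rewrite tnth_mktuple mulr0.
  by rewrite lebesgue_int_box_cos// ltry.
apply: (le_integrable measurableT _ _ intb).
  by apply/measurable_EFinP/measurable_funM => //; exact: measurable_box_indic.
by move=> w _ /=; rewrite lee_fin normrM ler_piMr.
Qed.

Let measurable_cos_scale (c : R) (z : d.-tuple R) :
  measurable_fun [set: d.-tuple R] (fun w => cos (c * dotp w z)).
Proof. by under eq_fun do rewrite -dotp_scale; exact: measurable_cos_dotp. Qed.

Lemma Rintegral_box_cos (c : R) (z : d.-tuple R) :
  \int[mu]_w (box_indic W w * cos (c * dotp w z)) = \prod_(i < d) box_cos W (c * tnth z i).
Proof.
have intc := integrable_box _ (measurable_cos_scale c z) (fun w => normr_cos_le1 _).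
rewrite /Rintegral -(Hint _ intc).
rewrite (_ : _ \o _ = (fun w : d.-tuple R => (1 * box_indic W w * cos (dotp w [tuple c * tnth z i | i < d] + 0))%:E)).
  rewrite lebesgue_int_box_cos//= mul1r cos0 mulr1; apply: eq_bigr => i _.
  by rewrite tnth_mktuple.
by apply/funext => w /=; rewrite addr0 dotp_scale mul1r.
Qed.

Lemma prod_box_cos_le (c : R) (z : d.-tuple R) :
  \prod_(i < d) box_cos W (c * tnth z i) <= (2 * W) ^+ d.
Proof.
apply: (le_trans (ler_norm _)); rewrite normr_prod -[d in _ ^+ d]card_ord -prodr_const.
by apply: ler_prod => i _; rewrite normr_ge0 box_cos_le.
Qed.

(** Coordinate [i] uses the decay of [box_cos], the others the uniform bound [2 W]; [1 <= W] turns
    [2 / |z_i|] into [2 W / |z_i|]. *)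
Lemma prod_box_cos_le_inv (c : R) (z : d.-tuple R) (i : 'I_d) : 1 <= `|c| ->
  tnth z i != 0 ->
  \prod_(i < d) box_cos W (c * tnth z i) <= (2 * W) ^+ d / `|tnth z i|.
Proof.
move=> c1 zi; apply: (le_trans (ler_norm _)); rewrite normr_prod (bigD1 i)//=.
have z0 : 0 < `|tnth z i| by rewrite normr_gt0.
have c0 : 0 < `|c| by exact: lt_le_trans c1.
have -> : (2 * W) ^+ d = (2 * W) * \prod_(j < d | j != i) (2 * W).
  by rewrite -[d in _ ^+ d]card_ord -prodr_const (bigD1 i).
rewrite mulrAC; apply: ler_pM => //; first exact: prodr_ge0.
  apply: (le_trans (box_cos_le_inv _ _ _)).
    by rewrite mulf_neq0// -normr_gt0.
  rewrite normrM ler_pM ?invr_ge0 ?mulr_ge0//; first by rewrite ler_peMr.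
  by rewrite lef_pV2 ?posrE ?mulr_gt0// ler_peMl// ltW.
by apply: ler_prod => j _; rewrite normr_ge0 box_cos_le.
Qed.

(** Expanding the square and turning products of cosines into sums leaves the frequencies [j - k]
    and [j + k]. Only the [n] diagonal pairs produce frequency zero, hence the full volume of the
    box; every other integer frequency has modulus at least 1 and gains [1 / |z_i|]. *)
Lemma box_mean_cos_sqr_le (z : d.-tuple R) (i : 'I_d) (n : nat) : (0 < n)%N ->
  tnth z i != 0 ->
  \int[mu]_w (box_indic W w * (n%:R^-1 * \sum_(j < n) cos (j.+1%:R * dotp w z)) ^+ 2) <=
  (2 * W) ^+ d * (n%:R^-1 + `|tnth z i|^-1).
Proof.
move=> n0 zi; have n0' : 0 < n%:R :> R by rewrite ltr0n.
pose V := (2 * W) ^+ d; have V0 : 0 <= V by rewrite exprn_ge0// mulr_ge0// ltW.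
pose I (c : R) w := box_indic W w * cos (c * dotp w z).
have intI c : mu.-integrable setT (EFin \o I c).
  exact: integrable_box (measurable_cos_scale c z) (fun w => normr_cos_le1 _).
pose J (jk : 'I_n * 'I_n) w := I (jk.1%:R - jk.2%:R) w + I (jk.1.+1%:R + jk.2.+1%:R) w.
have intJ jk : mu.-integrable setT (EFin \o J jk).
  exact: integrable_EFinD.
have E w : box_indic W w * (n%:R^-1 * \sum_(j < n) cos (j.+1%:R * dotp w z)) ^+ 2 =
    (n%:R^-1 ^+ 2 / 2) * \sum_(jk : 'I_n * 'I_n) J jk w.
  rewrite exprMn [X in _ * (_ * X)]expr2 big_distrlr/= pair_bigA/= mulrCA -mulrA; congr (_ * _).
  rewrite !mulr_sumr; apply: eq_bigr => -[j k] _ /=; rewrite /J /I/=.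
  have -> : (j%:R - k%:R) * dotp w z = j.+1%:R * dotp w z - k.+1%:R * dotp w z.
    by rewrite -!natr1; ring.
  by rewrite mulrDl cosB cosD; field.
under eq_Rintegral do rewrite E.
rewrite RintegralZl//; last exact: integrable_Rsum.
rewrite Rintegral_sum//.
have bJ jk : \int[mu]_w J jk w <= 2 * V * ((jk.1 == jk.2)%:R + `|tnth z i|^-1).
  have iz0 : 0 <= V * `|tnth z i|^-1 by rewrite mulr_ge0.
  rewrite /J RintegralD//.
  rewrite /I !Rintegral_box_cos.
  have h2 : \prod_(i < d) box_cos W ((jk.1.+1%:R + jk.2.+1%:R) * tnth z i) <= V / `|tnth z i|.
    apply: (prod_box_cos_le_inv (jk.1.+1%:R + jk.2.+1%:R) z i _ zi).
    by rewrite ger0_norm ?addr_ge0// -natrD ler1n addSn.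
  have [jk12|jk12] := eqVneq jk.1 jk.2.
    have := prod_box_cos_le (jk.1%:R - jk.2%:R) z; rewrite -/V mulrDr mulr1 => ?; lra.
  have h1 : \prod_(i < d) box_cos W ((jk.1%:R - jk.2%:R) * tnth z i) <= V / `|tnth z i|.
    apply: (prod_box_cos_le_inv (jk.1%:R - jk.2%:R) z i _ zi).
    have : (jk.1 : nat) != jk.2 by [].
    rewrite neq_ltn => /orP[lt12|lt12].
      by rewrite distrC -natrB 1?ltnW// ger0_norm// ler1n subn_gt0.
    by rewrite -natrB 1?ltnW// ger0_norm// ler1n subn_gt0.
  by rewrite add0r; lra.
have c0 : 0 <= n%:R^-1 ^+ 2 / 2 :> R by rewrite divr_ge0// sqr_ge0.
apply: (le_trans (ler_wpM2l c0 (ler_sum _ (fun jk _ => bJ jk)))).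
rewrite -mulr_sumr big_split/= sumr_const card_prod card_ord.
have -> : \sum_(jk : 'I_n * 'I_n) (jk.1 == jk.2)%:R = n%:R :> R.
  rewrite -(pair_bigA _ (fun j k : 'I_n => (j == k)%:R))/=.
  rewrite (eq_bigr (fun=> 1)) ?sumr_const ?card_ord// => j _.
  by rewrite (bigD1 j)//= eqxx big1 ?addr0// => k kj; rewrite eq_sym (negbTE kj).
rewrite -[_ *+ (n * n)]mulr_natr natrM le_eqVlt; apply/orP; left; apply/eqP.
rewrite -/V.
have zn : `|tnth z i| != 0 by rewrite normr_eq0.
by field; rewrite zn gt_eqF.
Qed.

End BoxMeanSquare.

(** * Lower bound for 1 - K *)

Lemma normr_sin_mulrn_le {R : realType} (n : nat) (x : R) : `|sin (n%:R * x)| <= n%:R * `|sin x|.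
Proof.
elim: n => [|n IH]; first by rewrite !mul0r sin0 normr0.
rewrite -natr1 !mulrDl !mul1r sinD (le_trans (ler_normD _ _))// !normrM lerD//.
  by apply: le_trans IH; rewrite ler_piMr// normr_cos_le1.
by rewrite ler_piMl// normr_cos_le1.
Qed.

Lemma one_sub_cos_mulrn_le {R : realType} (n : nat) (x : R) :
  1 - cos (n%:R * x) <= n%:R ^+ 2 * (1 - cos x).
Proof.
rewrite !one_sub_cosE [leRHS]mulrCA ler_wpM2l// -exprMn -mulrA.
rewrite -[leLHS]real_normK ?num_real// -[leRHS]real_normK ?num_real//.
by rewrite ler_sqr ?nnegrE// normrM normr_nat normr_sin_mulrn_le.
Qed.

Section KernelLowerBound.
Context {R : realType} {d : nat} (mu : {sigma_finite_measure set (d.-tuple R) -> \bar R})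
  (Q : probability (d.-tuple R) R) (p : d.-tuple R -> R).
Hypothesis Hint : forall f : d.-tuple R -> \bar R, mu.-integrable [set: d.-tuple R] f ->
  lebesgue_int f = (\int[mu]_w f w)%E.
Hypothesis Hge0 : forall f : d.-tuple R -> \bar R, measurable_fun [set: d.-tuple R] f ->
  (forall w, 0 <= f w)%E -> lebesgue_int f = (\int[mu]_w f w)%E.
Hypothesis Qp : forall f : d.-tuple R -> R, Q.-integrable [set: d.-tuple R] (EFin \o f) ->
  (\int[Q]_x (f x)%:E = \int[mu]_x (f x * p x)%:E)%E.
Hypothesis mp : measurable_fun [set: d.-tuple R] p.
Hypothesis p0 : forall w, 0 <= p w.

(** On [A N] both [w] and its density are bounded, so the expectation of a nonnegative function over
    [A N] is at most [N] times its integral over a box. *)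
Let A (N : nat) : set (d.-tuple R) :=
  [set w | (forall i, `|tnth w i| <= N%:R) /\ p w <= N%:R].

Let measurable_A N : measurable (A N).
Proof.
rewrite (_ : A N = (\bigcap_(i in [set: 'I_d]) ~` [set w | N%:R < `|tnth w i|]) `&` ~` [set w | N%:R < p w]).
  apply: measurableI; last by apply: measurableC; exact: measurable_superlevel.
  apply: fin_bigcap_measurable => // i _; apply: measurableC.
  apply: (measurable_superlevel (fun w : d.-tuple R => `|tnth w i|)).
  by apply: (measurableT_comp (@normr_measurable R setT)); exact: measurable_tnth.
apply/seteqP; split => w /=.
  case=> wN pN; split; last by apply/negP; rewrite -leNgt.
  by move=> i _ /=; apply/negP; rewrite -leNgt.
case=> wN /negP; rewrite -leNgt => pN; split => // i.
by have /negP := wN i I; rewrite -leNgt.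
Qed.

(** The sets [A N] increase to the whole space. The value [7/8] fits the budget
    [1/4 + 1/8 + 1/8 = 1/2] spent on the averaged cosine below. *)
Let A_large : exists N : nat, (0 < N)%N /\ ((7%:R / 8%:R)%:E <= Q (A N))%E.
Proof.
apply: contrapT => /forallNP h.
have cv : Q (A n) @[n --> \oo] --> Q (\bigcup_n A n).
  apply: nondecreasing_cvg_mu => //; first exact: bigcup_measurable.
  move=> n m nm; apply/subsetPset => w [wN pN]; split.
    by move=> i; rewrite (le_trans (wN i))// ler_nat.
  by rewrite (le_trans pN)// ler_nat.
have AT : \bigcup_n A n = [set: d.-tuple R].
  apply/seteqP; split => // w _.
  pose x := p w + \sum_(i < d) `|tnth w i|.
  have xN : x <= (Num.truncn x).+1%:R by exact: ltW (truncnS_gt _).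
  exists (Num.truncn x).+1 => //; split => [i|]; apply: le_trans xN.
    by rewrite /x (bigD1 i)//= addrCA lerDl addr_ge0// sumr_ge0.
  by rewrite /x lerDl sumr_ge0.
have : (Q (\bigcup_n A n) <= (7%:R / 8%:R)%:E)%E.
  rewrite -(cvg_lim _ cv)//; apply: lime_le; first by apply/cvg_ex; eexists; exact: cv.
  near=> n; have n0 : (0 < n)%N by near: n; exact: nbhs_infty_gt.
  by have /not_andP[//|/negP] := h n; rewrite -ltNge => /ltW.
rewrite AT probability_setT lee_fin; lra.
Unshelve. all: by end_near.
Qed.

Let cosmean (n : nat) (z w : d.-tuple R) : R := n%:R^-1 * \sum_(j < n) cos (j.+1%:R * dotp w z).

Let cosmean_le1 n z w : (0 < n)%N -> `|cosmean n z w| <= 1.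
Proof.
move=> n0; rewrite /cosmean normrM normfV normr_nat mulrC ler_pdivrMr ?ltr0n// mul1r.
apply: (le_trans (ler_norm_sum _ _ _)).
apply: (@le_trans _ _ (\sum_(j < n) 1)); last by rewrite sumr_const card_ord.
by apply: ler_sum => j _; exact: normr_cos_le1.
Qed.

Let measurable_cosmean n z : measurable_fun [set: d.-tuple R] (cosmean n z).
Proof.
apply: measurable_funM => //; apply: measurable_sum => j.
by under eq_fun do rewrite -dotp_scale; exact: measurable_cos_dotp.
Qed.

Let integrable_one_sub_cos z : Q.-integrable [set: d.-tuple R] (EFin \o (fun w => 1 - cos (dotp w z))).
Proof.
apply: (@integrable_bounded _ _ _ _ _ 2).
  by apply: measurable_funB => //; exact: measurable_cos_dotp.
by move=> w; have /andP[h1 h2] := one_sub_cos_itv (dotp w z); rewrite ger0_norm.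
Qed.

(** A substitute for the Riemann-Lebesgue lemma. The mean [S] of the cosines is squared to make the
    integrand nonnegative: on [A N] the density can then be replaced by its bound [N], and only
    integrals of cosines over a box remain. Once [E S <= 1/2], the claim follows since [1 - S]
    averages [1 - cos (j a) <= n^2 (1 - cos a)] with [a = <w, z>]. *)
Lemma one_sub_cos_expectation_ge : exists (n : nat) (R0 : R), (0 < n)%N /\ 0 < R0 /\
  forall (z : d.-tuple R) (i : 'I_d), R0 <= `|tnth z i| ->
  1 / 2 <= n%:R ^+ 2 * \int[Q]_w (1 - cos (dotp w z)).
Proof.
have [N [N0 QN]] := A_large.
have N1 : 1 <= N%:R :> R by rewrite ler1n.
pose V := N%:R * (2 * N%:R) ^+ d : R.
have V0 : 0 < V by rewrite mulr_gt0 ?exprn_gt0 ?mulr_gt0 ?ltr0n.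
(* [V] is the density bound times the volume of the box; [16 V] makes each of the errors [V / n] and
   [V / |z_i|] at most [1 / 16]. *)
pose n := (Num.truncn (16 * V)).+1; pose R0 := 16 * V.
have n0' : 16 * V <= n%:R by exact: ltW (truncnS_gt _).
have R00 : 0 < R0 by rewrite mulr_gt0.
have n0 : 0 < n%:R :> R by rewrite ltr0n.
exists n, R0; split => //; split => // z i zi.
have zi0 : tnth z i != 0 by rewrite -normr_gt0 (lt_le_trans R00).
pose S := cosmean n z.
have intS : Q.-integrable [set: d.-tuple R] (EFin \o S).
  apply: (@integrable_bounded _ _ _ _ _ 1); first exact: measurable_cosmean.
  by move=> w; exact: (cosmean_le1 n z w isT).
have intAS : Q.-integrable [set: d.-tuple R] (EFin \o (fun w => \1_(A N) w * S w ^+ 2)).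
  apply: (@integrable_bounded _ _ _ _ _ 1).
    by apply: measurable_funM; [exact: measurable_indic|apply: measurable_funX; exact: measurable_cosmean].
  move=> w; rewrite indicE normrM normrX normr_nat mulr_ile1 ?exprn_ge0// ?lern1 ?leq_b1//.
  by rewrite exprn_ile1// (cosmean_le1 n z w isT).
have intA : Q.-integrable [set: d.-tuple R] (EFin \o (\1_(A N) : d.-tuple R -> R)).
  apply: (@integrable_bounded _ _ _ _ _ 1); first exact: measurable_indic.
  by move=> w; rewrite indicE normr_nat lern1 leq_b1.
have intc (c : R) : Q.-integrable [set: d.-tuple R] (EFin \o (fun=> c)).
  by apply: (@integrable_bounded _ _ _ _ _ `|c|).
have ES : \int[Q]_w S w <= 1 / 2.
  have EA : 7 / 8 <= \int[Q]_w \1_(A N) w.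
    by rewrite Rintegral_indic// -lee_fin fineK// fin_num_measure.
  have EAS : \int[Q]_w (\1_(A N) w * S w ^+ 2) <= 1 / 8.
    rewrite /Rintegral Qp//.
    have intbox := integrable_box mu Hge0 N%:R N1 (fun w => S w ^+ 2).
    have {}intbox : mu.-integrable [set: d.-tuple R] (EFin \o (fun w => box_indic N%:R w * S w ^+ 2)).
      apply: intbox; first by apply: measurable_funX; exact: measurable_cosmean.
      by move=> w; rewrite normrX exprn_ile1// (cosmean_le1 n z w isT).
    have b0 w : 0 <= @box_indic R d N%:R w by have /andP[] := box_indic_itv N%:R w.
    have bound : (\int[mu]_w (\1_(A N) w * S w ^+ 2 * p w)%:E <=
        \int[mu]_w (N%:R * (box_indic N%:R w * S w ^+ 2))%:E)%E.
      have m1 : measurable_fun [set: d.-tuple R] (fun w => (\1_(A N) w * S w ^+ 2 * p w)%:E).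
        apply/measurable_EFinP/measurable_funM => //; apply: measurable_funM; first exact: measurable_indic.
        by apply: measurable_funX; exact: measurable_cosmean.
      have m2 : measurable_fun [set: d.-tuple R] (fun w => (N%:R * (box_indic N%:R w * S w ^+ 2))%:E).
        by apply: (measurable_int mu); exact: integrable_EFinZl.
      have l0 w : (0 <= (\1_(A N) w * S w ^+ 2 * p w)%:E)%E.
        rewrite lee_fin; apply: mulr_ge0 => //; apply: mulr_ge0; last exact: sqr_ge0.
        by rewrite indicE ler0n.
      have r0 w : (0 <= (N%:R * (box_indic N%:R w * S w ^+ 2))%:E)%E.
        by rewrite lee_fin; apply: mulr_ge0 => //; apply: mulr_ge0 => //; exact: sqr_ge0.
      apply: ge0_le_integral => //.
      move=> w _; rewrite lee_fin indicE; have [wA|wA] := boolP (w \in A N); last first.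
        by have := r0 w; rewrite !mul0r lee_fin.
      have [wN pN] := set_mem wA; rewrite mul1r mulrC.
      have -> : @box_indic R d N%:R w = 1.
        rewrite /box_indic big1// => j _; rewrite indicE mem_set//=.
        by rewrite in_itv/= -ler_norml.
      by rewrite mul1r ler_wpM2r// sqr_ge0.
    have finR : (\int[mu]_w (N%:R * (box_indic N%:R w * S w ^+ 2))%:E)%E \is a fin_num.
      by apply: integrable_fin_num => //; exact: integrable_EFinZl.
    have finL : (\int[mu]_w (\1_(A N) w * S w ^+ 2 * p w)%:E)%E \is a fin_num.
      by rewrite -Qp//; exact: integrable_fin_num.
    apply: (@le_trans _ _ (\int[mu]_w (N%:R * (box_indic N%:R w * S w ^+ 2)))); first exact: fine_le.
    rewrite RintegralZl//.
    have := box_mean_cos_sqr_le mu Hint Hge0 N%:R N1 z i n isT zi0.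
    rewrite -/(cosmean n z) => hb.
    have N00 : 0 <= N%:R :> R by [].
    apply: (le_trans (ler_wpM2l N00 hb)); rewrite mulrA -/V.
    have i1 : n%:R^-1 <= (16 * V)^-1 by rewrite lef_pV2// posrE mulr_gt0.
    have i2 : `|tnth z i|^-1 <= (16 * V)^-1 by rewrite lef_pV2// posrE ?(lt_le_trans R00)// mulr_gt0.
    apply: (@le_trans _ _ (V * ((16 * V)^-1 + (16 * V)^-1))); first by apply: ler_wpM2l; [exact: ltW|exact: lerD].
    by rewrite le_eqVlt; apply/orP; left; apply/eqP; field; rewrite gt_eqF.
  (* On [A N], [S <= 1/4 + S^2] because [(S - 1/2)^2 >= 0]; off it, [S <= 1]. *)
  apply: (@le_trans _ _ (\int[Q]_w (1 / 4 + (1 - \1_(A N) w + \1_(A N) w * S w ^+ 2)))).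
    apply: le_Rintegral => //.
      apply: integrable_EFinD => //; apply: integrable_EFinD => //; exact: integrable_EFinB.
    move=> w _; have S1 : S w ^+ 2 <= 1 by rewrite -real_normK ?num_real// exprn_ile1// (cosmean_le1 n z w isT).
    have S4 : S w <= 1 / 4 + S w ^+ 2 by have := sqr_ge0 (S w - 1 / 2); nra.
    rewrite indicE; case: (w \in A N); rewrite /= ?mulr1n ?mulr0n ?mul1r ?mul0r; lra.
  rewrite RintegralD//; last by apply: integrable_EFinD => //; exact: integrable_EFinB.
  rewrite RintegralD//; last exact: integrable_EFinB.
  rewrite RintegralB// !Rintegral_prob_cst; lra.
have pt w : 1 - S w <= n%:R ^+ 2 * (1 - cos (dotp w z)).
  have /andP[c0 _] := one_sub_cos_itv (dotp w z).
  have -> : 1 - S w = n%:R^-1 * \sum_(j < n) (1 - cos (j.+1%:R * dotp w z)).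
    by rewrite big_split/= sumr_const card_ord sumrN mulrBr mulVf ?gt_eqF.
  rewrite mulrC ler_pdivrMr//.
  apply: (@le_trans _ _ (\sum_(j < n) n%:R ^+ 2 * (1 - cos (dotp w z)))); last first.
    by rewrite sumr_const card_ord mulr_natr.
  apply: ler_sum => j _; apply: (le_trans (one_sub_cos_mulrn_le _ _)).
  by rewrite ler_wpM2r// ler_sqr ?nnegrE// ler_nat.
apply: (@le_trans _ _ (\int[Q]_w (1 - S w))).
  by rewrite RintegralB// Rintegral_prob_cst; lra.
rewrite -RintegralZl//; apply: le_Rintegral => //; first exact: integrable_EFinB.
exact: integrable_EFinZl.
Qed.

(** The bound for far points is applied to [m z], where the integer [m] brings the largest
    coordinate [M] of [z] up to [R0]; this gives [m^2 E >= 1 / (2 n^2)]. Against it stands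
    [1 - cos <w, z> <= |w|_1^2 M^2 / 2], and [M m] is of the order of [R0] unless [m = 1]. *)
Lemma one_sub_cos_dominated : exists C0 : R, 0 < C0 /\ forall z w : d.-tuple R,
  1 - cos (dotp w z) <= C0 * (1 + norm1 w) ^+ 2 * \int[Q]_v (1 - cos (dotp v z)).
Proof.
have [n [R0 [n0 [R00 hR]]]] := one_sub_cos_expectation_ge.
have n1 : 1 <= n%:R :> R by rewrite ler1n.
(* The first term serves [m = 1], where the bound [1 - cos <= 2] suffices; the second serves
   [m >= 2]. *)
pose C0 := 4 * n%:R ^+ 2 + 4 * R0 ^+ 2 * n%:R ^+ 2.
have C00 : 0 < C0.
  have n00 : 0 < n%:R :> R by rewrite (lt_le_trans _ n1).
  by rewrite addr_gt0 ?mulr_gt0 ?exprn_gt0.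
exists C0; split => //.
move=> z w; set E := \int[Q]_v _.
have nw : 0 <= norm1 w by exact: sumr_ge0.
have E0 : 0 <= E.
  by apply: Rintegral_ge0 => v _; case/andP: (one_sub_cos_itv (dotp v z)).
have [|/existsNP[i0 /eqP zi0]] := pselect (forall i, tnth z i = 0).
  move=> z0; rewrite /dotp big1 => [|i _]; last by rewrite z0 mulr0.
  rewrite cos0 subrr; apply: mulr_ge0 => //; apply: mulr_ge0; last exact: sqr_ge0.
  exact: ltW.
have [i _ zmax] := @Order.TotalTheory.arg_maxP _ _ _ i0 xpredT (fun i => `|tnth z i|) isT.
set M := `|tnth z i| in zmax *.
have M0 : 0 < M by apply: lt_le_trans (zmax i0 isT); rewrite normr_gt0.
pose m := (Num.truncn (R0 / M)).+1.
have m1 : R0 / M <= m%:R by exact: ltW (truncnS_gt _).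
have m2 : (m%:R - 1) * M <= R0.
  rewrite -ler_pdivlMr// -natr1 addrK.
  by rewrite truncn_le divr_ge0 ?ltW.
have Em : 1 / 2 <= n%:R ^+ 2 * (m%:R ^+ 2 * E).
  pose z' := [tuple m%:R * tnth z j | j < d].
  have h : R0 <= `|tnth z' i|.
    by rewrite tnth_mktuple normrM normr_nat -ler_pdivrMr.
  apply: (le_trans (hR z' i h)); rewrite ler_wpM2l ?sqr_ge0//.
  rewrite /E -RintegralZl//; apply: le_Rintegral => //; first exact: integrable_EFinZl.
  by move=> v _; rewrite dotp_scale; exact: one_sub_cos_mulrn_le.
have X2 : 1 - cos (dotp w z) <= 2 by case/andP: (one_sub_cos_itv (dotp w z)).
have Xq : 1 - cos (dotp w z) <= norm1 w ^+ 2 * M ^+ 2 / 2.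
  apply: (le_trans (one_sub_cos_le _)); rewrite ler_wpM2r// -exprMn.
  rewrite -real_normK ?num_real// ler_sqr ?nnegrE ?mulr_ge0 ?(ltW M0)//.
  rewrite /dotp; apply: (le_trans (ler_norm_sum _ _ _)); rewrite /norm1 mulr_suml.
  by apply: ler_sum => j _; rewrite normrM ler_wpM2l//; exact: zmax.
have nE0 : 0 <= n%:R ^+ 2 * E by rewrite mulr_ge0// sqr_ge0.
have w1 : 1 <= (1 + norm1 w) ^+ 2 by rewrite expr_ge1//; lra.
have w2 : norm1 w ^+ 2 <= (1 + norm1 w) ^+ 2 by rewrite ler_sqr ?nnegrE; lra.
have R02 : 0 <= R0 ^+ 2 by exact: sqr_ge0.
have -> : C0 * (1 + norm1 w) ^+ 2 * E =
  (4 * (n%:R ^+ 2 * E)) * (1 + norm1 w) ^+ 2 + (4 * R0 ^+ 2 * (n%:R ^+ 2 * E)) * (1 + norm1 w) ^+ 2 by rewrite /C0; ring.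
have a1 : 4 * (n%:R ^+ 2 * E) <= (4 * (n%:R ^+ 2 * E)) * (1 + norm1 w) ^+ 2.
  by rewrite ler_peMr// mulr_ge0.
have a2 : (4 * R0 ^+ 2 * (n%:R ^+ 2 * E)) * norm1 w ^+ 2 <= (4 * R0 ^+ 2 * (n%:R ^+ 2 * E)) * (1 + norm1 w) ^+ 2.
  by rewrite ler_wpM2l// mulr_ge0// mulr_ge0.
have b1 : 0 <= 4 * (n%:R ^+ 2 * E) by rewrite mulr_ge0.
have b2 : 0 <= (4 * R0 ^+ 2 * (n%:R ^+ 2 * E)) * norm1 w ^+ 2.
  by rewrite mulr_ge0 ?sqr_ge0// mulr_ge0// mulr_ge0.
have [m_1|m_gt1] := leqP m 1.
  have m1E : m%:R = 1 :> R by rewrite (_ : m = 1%N)//; apply/eqP; rewrite eqn_leq m_1.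
  move: Em; rewrite m1E expr1n mul1r => Em; lra.
have m2' : 2 <= m%:R :> R by rewrite ler_nat.
(* From [(m - 1) M <= R0] and [m <= 2 (m - 1)]. *)
have Mm : M * m%:R <= 2 * R0 by nra.
have Mm2 : (M * m%:R) ^+ 2 <= 4 * R0 ^+ 2.
  have -> : 4 * R0 ^+ 2 = (2 * R0) ^+ 2 by ring.
  by rewrite ler_sqr ?nnegrE ?mulr_ge0 ?(ltW M0) ?(ltW R00).
have nw2 : 0 <= norm1 w ^+ 2 by exact: sqr_ge0.
have t1 : M ^+ 2 / 2 <= (M * m%:R) ^+ 2 * (n%:R ^+ 2 * E).
  have -> : (M * m%:R) ^+ 2 * (n%:R ^+ 2 * E) = M ^+ 2 * (n%:R ^+ 2 * (m%:R ^+ 2 * E)) by ring.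
  by have := ler_wpM2l (sqr_ge0 M) Em; rewrite mul1r.
have t2 : M ^+ 2 / 2 <= 4 * R0 ^+ 2 * (n%:R ^+ 2 * E) by apply: (le_trans t1); rewrite ler_wpM2r.
have t3 : norm1 w ^+ 2 * (M ^+ 2 / 2) <= norm1 w ^+ 2 * (4 * R0 ^+ 2 * (n%:R ^+ 2 * E)) by rewrite ler_wpM2l.
move: t3; rewrite mulrA [X in _ <= X -> _]mulrC => t3; lra.
Qed.

End KernelLowerBound.

(** * Chernoff bounds for independent samples *)

(** From [exp x <= 1 / (1 - x)] and [(1 + x + 2 x^2) (1 - x) = 1 + x^2 (1 - 2 x)]. There is no lower
    limit on [x], so the lower tail can use [X] without truncation. *)
Lemma expR_le_quadratic {R : realType} (x : R) : x <= 1 / 2 -> expR x <= 1 + x + 2 * x ^+ 2.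
Proof.
move=> x2; have h := expR_ge1Dx (- x).
have x1 : 0 < 1 - x by lra.
have -> : expR x = (expR (- x))^-1 by rewrite expRN invrK.
apply: (@le_trans _ _ (1 - x)^-1).
  by rewrite lef_pV2 ?posrE ?expR_gt0.
rewrite -[leLHS]mul1r ler_pdivrMr//.
have : 0 <= x ^+ 2 * (1 - 2 * x) by rewrite mulr_ge0 ?sqr_ge0//; lra.
nra.
Qed.

Section Concentration.
Context {R : realType} {dO dT : measure_display} {Omega : measurableType dO}
  {T : measurableType dT}.
Context (P : probability Omega R) (Q : probability T R) (D : nat)
  (w : 'I_D -> Omega -> T).
Hypothesis mw : forall j, measurable_fun setT (w j).
Hypothesis lawP : forall j A, measurable A -> P (w j @^-1` A) = Q A.
Hypothesis indepP : forall A : 'I_D -> set T, (forall j, measurable (A j)) ->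
  P [set t | forall j, A j (w j t)] = (\prod_(j < D) P (w j @^-1` A j))%E.

Let measurable_sumw (Y : T -> R) : measurable_fun setT Y ->
  measurable_fun setT (fun t => \sum_(j < D) Y (w j t)).
Proof. by move=> mY; apply: measurable_sum => j; exact: measurableT_comp. Qed.

Let integrable_indic d0 (U : measurableType d0) (N : probability U R) (A : set U) :
  measurable A -> N.-integrable setT (EFin \o (\1_A : U -> R)).
Proof.
move=> mA; apply: (@integrable_bounded _ _ _ _ _ 1); first exact: measurable_indic.
by move=> x; rewrite indicE normr_nat lern1 leq_b1.
Qed.

(** The exponential parameter is part of [Y], so that one inequality serves both tails. *)
Lemma chernoff_bound (Y : T -> R) (M a c : R) : measurable_fun setT Y ->
  (forall x, Y x <= M) -> \int[Q]_x expR (Y x) <= expR a ->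
  \int[P]_t \1_[set t | c < \sum_(j < D) Y (w j t)] t <= expR (D%:R * a - c).
Proof.
move=> mY YM Ea.
have mA : measurable [set t | c < \sum_(j < D) Y (w j t)].
  by apply: measurable_superlevel; exact: measurable_sumw.
have mexp : measurable_fun setT (fun x => expR (Y x)) by exact: measurableT_comp.
have prodE t : \prod_(j < D) expR (Y (w j t)) = expR (\sum_(j < D) Y (w j t)).
  by rewrite expR_sum.
have intprod : P.-integrable setT (EFin \o (fun t => \prod_(j < D) expR (Y (w j t)))).
  apply: (@integrable_bounded _ _ _ _ _ (expR M ^+ D)).
    by apply: measurable_prod => j _; exact: (measurableT_comp mexp).
  move=> t; rewrite normr_prod -[D in _ ^+ D]card_ord -prodr_const ler_prod// => j _.
  by rewrite normr_ge0/= ger0_norm ?expR_ge0// ler_expR; exact: YM.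
apply: (@le_trans _ _ (\int[P]_t (expR (- c) * \prod_(j < D) expR (Y (w j t))))).
  apply: le_Rintegral => //; [exact: integrable_indic|exact: integrable_EFinZl|].
  move=> t _; rewrite prodE -expRD indicE; have [tA|tA] := boolP (_ \in _); last exact: expR_ge0.
  have := set_mem tA => /= ct; apply: le_trans (expR_ge1Dx _); lra.
rewrite RintegralZl// expRD mulrC ler_wpM2r ?expR_ge0//.
have := iid_expectation_prod_le P Q D w mw lawP indepP (fun x => expR (Y x)) (expR M) mexp.
move=> h; apply: (le_trans (h _)).
  by move=> x; rewrite expR_ge0 ler_expR YM.
rewrite expRM_natl; apply: lerXn2r => //; rewrite nnegrE ?expR_ge0//.
by apply: Rintegral_ge0 => x _; exact: expR_ge0.
Qed.

(** The expected number of samples beyond [v] stands in for the probability that there is one. *)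
Lemma union_tail_bound (V : T -> R) (v b : R) : measurable_fun setT V ->
  \int[Q]_x \1_[set x | v < V x] x <= b ->
  \int[P]_t (\sum_(j < D) \1_[set x | v < V x] (w j t)) <= D%:R * b.
Proof.
move=> mV Qb; have mA : measurable [set x | v < V x] by exact: measurable_superlevel.
have mAw j : measurable (w j @^-1` [set x | v < V x]).
  by rewrite -[X in measurable X]setTI; exact: mw.
have E j : (fun t => \1_[set x | v < V x] (w j t)) = \1_(w j @^-1` [set x | v < V x]) :> (Omega -> R).
  by apply/funext => t; rewrite !indicE.
rewrite Rintegral_sum; last by move=> j; rewrite E; exact: integrable_indic.
apply: (@le_trans _ _ (\sum_(j < D) b)); last by rewrite sumr_const card_ord mulr_natl.
apply: ler_sum => j _; rewrite E Rintegral_indic// lawP//.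
by move: Qb; rewrite Rintegral_indic.
Qed.

Context (X V : T -> R) (mX : measurable_fun setT X) (mV : measurable_fun setT V).
Hypothesis X02 : forall x, 0 <= X x <= 2.
Hypothesis V1 : forall x, 1 <= V x.
Context (C0 t0 B : R) (C00 : 0 < C0) (t00 : 0 < t0).
Hypothesis intV : Q.-integrable setT (EFin \o (fun x => expR (t0 * V x))).
Hypothesis EV : \int[Q]_x expR (t0 * V x) <= B.
Local Notation mu := (\int[Q]_x X x).
Hypothesis mu0 : 0 < mu.
Hypothesis XV : forall x, X x <= C0 * V x ^+ 2 * mu.

Let C2 := C0 ^+ 2 * (4 / t0) ^+ 4 * B.

Let bounded_between (Y : T -> R) : measurable_fun setT Y -> (forall x, 0 <= Y x <= X x) ->
  Q.-integrable setT (EFin \o Y) /\ Q.-integrable setT (EFin \o (fun x => Y x ^+ 2)).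
Proof.
move=> mY YX; have Y2 x : `|Y x| <= 2.
  by have /andP[y0 yx] := YX x; have /andP[_ x2] := X02 x; rewrite ger0_norm// (le_trans yx).
split; first exact: (integrable_bounded _ _ _ mY Y2).
apply: (@integrable_bounded _ _ _ _ _ (2 ^+ 2)); first exact: measurable_funX.
by move=> x; rewrite normrX lerXn2r// nnegrE.
Qed.

(** [X^2 <= C0^2 V^4 mu^2], and [V^4 <= (4 / t0)^4 exp (t0 V)]. The constant [C2] depends only on
    [C0], [t0] and [B]. [Y] is any function between 0 and [X], which covers both [X] and its
    truncation. *)
Let second_moment (Y : T -> R) : measurable_fun setT Y -> (forall x, 0 <= Y x <= X x) ->
  \int[Q]_x (Y x ^+ 2) <= C2 * mu ^+ 2.
Proof.
move=> mY YX; have [_ intY2] := bounded_between Y mY YX.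
pose c := C0 ^+ 2 * (4 / t0) ^+ 4 * mu ^+ 2.
have q0 : 0 <= 4 / t0 by apply: divr_ge0 => //; exact: ltW.
have c0 : 0 <= c.
  apply: mulr_ge0; last exact: sqr_ge0.
  by apply: mulr_ge0; [exact: sqr_ge0|exact: exprn_ge0].
apply: (@le_trans _ _ (\int[Q]_x (c * expR (t0 * V x)))); last first.
  rewrite RintegralZl//; apply: (le_trans (ler_wpM2l c0 EV)).
  by rewrite /c /C2 le_eqVlt; apply/orP; left; apply/eqP; ring.
apply: le_Rintegral => //; first exact: integrable_EFinZl.
move=> x _; have /andP[y0 yx] := YX x.
have V0 : 0 <= V x by apply: le_trans (V1 x).
have V4 : V x ^+ 4 <= (4 / t0) ^+ 4 * expR (t0 * V x).
  have -> : expR (t0 * V x) = expR (t0 * V x / 4) ^+ 4 by rewrite -expRM_natr; congr expR; field.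
  rewrite -exprMn lerXn2r ?nnegrE//; first by apply: mulr_ge0 => //; exact: expR_ge0.
  have h := expR_ge1Dx (t0 * V x / 4).
  apply: le_trans (ler_wpM2l q0 h); rewrite mulrDr mulr1.
  have -> : 4 / t0 * (t0 * V x / 4) = V x by field; rewrite gt_eqF.
  by rewrite lerDr.
apply: (@le_trans _ _ ((C0 * V x ^+ 2 * mu) ^+ 2)).
  rewrite lerXn2r ?nnegrE//; first by rewrite !mulr_ge0 ?sqr_ge0// ltW.
  exact: le_trans yx (XV x).
have -> : (C0 * V x ^+ 2 * mu) ^+ 2 = C0 ^+ 2 * mu ^+ 2 * V x ^+ 4 by ring.
have cc0 : 0 <= C0 ^+ 2 * mu ^+ 2 by rewrite mulr_ge0 ?sqr_ge0.
apply: (le_trans (ler_wpM2l cc0 V4)).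
by rewrite /c le_eqVlt; apply/orP; left; apply/eqP; ring.
Qed.

Let mgf_le (Y : T -> R) (l : R) : measurable_fun setT Y -> (forall x, 0 <= Y x <= X x) ->
  (forall x, l * Y x <= 1 / 2) ->
  \int[Q]_x expR (l * Y x) <= expR (l * (\int[Q]_x Y x) + 2 * l ^+ 2 * (C2 * mu ^+ 2)).
Proof.
move=> mY YX lY; have [intY intY2] := bounded_between Y mY YX.
have int1 : Q.-integrable setT (EFin \o (fun=> 1 : R)).
  by apply: (@integrable_bounded _ _ _ _ _ `|1|).
have intl : Q.-integrable setT (EFin \o (fun x => l * Y x)) by exact: integrable_EFinZl.
have intl2 : Q.-integrable setT (EFin \o (fun x => 2 * l ^+ 2 * Y x ^+ 2)) by exact: integrable_EFinZl.
apply: (@le_trans _ _ (\int[Q]_x (1 + l * Y x + 2 * l ^+ 2 * Y x ^+ 2))).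
  apply: le_Rintegral => //.
  - apply: (@integrable_bounded _ _ _ _ _ (expR (1 / 2))).
      by apply: measurableT_comp => //; exact: measurable_funM.
    by move=> x; rewrite ger0_norm ?expR_ge0// ler_expR.
  - by apply: integrable_EFinD => //; exact: integrable_EFinD.
  move=> x _; have := expR_le_quadratic (l * Y x) (lY x).
  by rewrite exprMn mulrA.
rewrite RintegralD//; last exact: integrable_EFinD.
rewrite RintegralD// Rintegral_prob_cst !RintegralZl// -addrA.
apply: le_trans (expR_ge1Dx _); rewrite !lerD2l; apply: ler_wpM2l; last exact: second_moment.
by apply: mulr_ge0 => //; exact: sqr_ge0.
Qed.

(** Three bad events share [delta]: the upper tail of the truncation [Y], the lower tail of [X], and
    the presence of a sample with [V > v]. Outside the last one the sums of [X] and [Y] agree.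
    Truncation only lowers the mean, so the upper tail of [Y] can be measured against [mu]. *)
Lemma iid_concentration (eps delta theta v : R) : 0 < eps -> 0 < delta -> 0 < theta ->
  theta * (4 * C2) <= eps -> theta * (C0 * v ^+ 2) <= 1 / 2 -> 0 <= v ->
  ln (3 / delta) <= D%:R * (theta * eps / 2) ->
  D%:R * (B * expR (- (t0 * v))) <= delta / 3 ->
  1 - delta <= \int[P]_t \1_[set t | `|\sum_(j < D) X (w j t) - D%:R * mu| <= eps * (D%:R * mu)] t.
Proof.
move=> eps0 delta0 theta0 hC2 hC0 v0 hD hB.
(* In this scale the exponents involve [mu] only through [l mu = theta]. *)
pose l := theta / mu; have l0 : 0 < l by rewrite divr_gt0.
have lmu : l * mu = theta by rewrite /l divfK// gt_eqF.
pose Y x := X x * \1_(~` [set x | v < V x]) x.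
have mtail : measurable [set x | v < V x] by exact: measurable_superlevel.
have mY : measurable_fun setT Y.
  by apply: measurable_funM => //; apply: measurable_indic; exact: measurableC.
have YX x : 0 <= Y x <= X x.
  have /andP[x0 _] := X02 x; rewrite /Y mulr_ge0 ?indicE ?ler0n//= ler_piMr// lern1 leq_b1//.
have [intY _] := bounded_between Y mY YX.
have intX : Q.-integrable setT (EFin \o X).
  by apply: (@integrable_bounded _ _ _ _ _ 2) => // x; have /andP[? ?] := X02 x; rewrite ger0_norm.
have XX x : 0 <= X x <= X x by have /andP[-> _] := X02 x; rewrite lexx.
have EYmu : \int[Q]_x Y x <= mu.
  by apply: le_Rintegral => // x _; have /andP[] := YX x.
have lY x : l * Y x <= 1 / 2.
  rewrite /Y indicE; have [xA|xA] := boolP (x \in _); last by rewrite !mulr0; lra.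
  rewrite mulr1; have /= := set_mem xA => /negP; rewrite -leNgt => Vv.
  have C0V : theta * (C0 * V x ^+ 2) <= 1 / 2.
    apply: le_trans hC0; apply: ler_wpM2l; first exact: ltW.
    apply: ler_wpM2l; first exact: ltW.
    by apply: lerXn2r => //; rewrite nnegrE (le_trans _ (V1 x)).
  apply: le_trans C0V; apply: (@le_trans _ _ (l * (C0 * V x ^+ 2 * mu))).
    by apply: ler_wpM2l; [exact: ltW|exact: XV].
  by rewrite -lmu le_eqVlt; apply/orP; left; apply/eqP; ring.
(* The quadratic term uses up half of the gain [theta eps] per sample; the other half has to reach
   [ln (3 / delta)]. *)
have key : 2 * l ^+ 2 * (C2 * mu ^+ 2) <= theta * eps / 2.
  have -> : 2 * l ^+ 2 * (C2 * mu ^+ 2) = theta * (theta * (4 * C2)) / 2.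
    by rewrite /l; field; rewrite gt_eqF.
  by rewrite ler_pM2r// ler_pM2l.
pose U1 := [set t | l * ((1 + eps) * (D%:R * mu)) < \sum_(j < D) (l * Y (w j t))].
pose U2 := [set t | - l * ((1 - eps) * (D%:R * mu)) < \sum_(j < D) (- l * X (w j t))].
have small : expR (- (D%:R * (theta * eps / 2))) <= delta / 3.
  have -> : delta / 3 = expR (- ln (3 / delta)).
    by rewrite expRN lnK ?posrE ?divr_gt0// invf_div.
  by rewrite ler_expR lerN2.
have P1 : \int[P]_t \1_U1 t <= delta / 3.
  have h := @chernoff_bound (fun x => l * Y x) (1 / 2) _ (l * ((1 + eps) * (D%:R * mu))) _ lY (mgf_le _ l mY YX lY).
  apply: (le_trans (h _)); first exact: measurable_funM.
  apply: le_trans small; rewrite ler_expR.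
  have : D%:R * (l * (\int[Q]_x Y x) + 2 * l ^+ 2 * (C2 * mu ^+ 2)) <= D%:R * (theta + theta * eps / 2).
    by rewrite ler_wpM2l// lerD// -lmu ler_wpM2l// ltW.
  have -> : l * ((1 + eps) * (D%:R * mu)) = D%:R * (theta + theta * eps) by rewrite -lmu; ring.
  lra.
have lX x : - l * X x <= 1 / 2.
  have /andP[x0 _] := X02 x; have : 0 <= l * X x by rewrite mulr_ge0// ltW.
  by rewrite mulNr => ?; lra.
have P2 : \int[P]_t \1_U2 t <= delta / 3.
  have h := @chernoff_bound (fun x => - l * X x) (1 / 2) _ (- l * ((1 - eps) * (D%:R * mu))) _ lX (mgf_le _ (- l) mX XX lX).
  apply: (le_trans (h _)); first exact: measurable_funM.
  apply: le_trans small; rewrite ler_expR sqrrN.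
  have : D%:R * (2 * l ^+ 2 * (C2 * mu ^+ 2)) <= D%:R * (theta * eps / 2) by rewrite ler_wpM2l.
  have -> : - l * ((1 - eps) * (D%:R * mu)) = - (D%:R * (theta - theta * eps)) by rewrite -lmu; ring.
  rewrite mulrDr mulNr lmu; lra.
have P3 : \int[P]_t (\sum_(j < D) \1_[set x | v < V x] (w j t)) <= delta / 3.
  apply: le_trans hB; apply: union_tail_bound => //.
  apply: (@le_trans _ _ (\int[Q]_x (expR (- (t0 * v)) * expR (t0 * V x)))); last first.
    by rewrite RintegralZl// mulrC ler_wpM2r ?expR_ge0.
  apply: le_Rintegral => //; [exact: integrable_indic|exact: integrable_EFinZl|].
  move=> x _; rewrite indicE; have [xA|xA] := boolP (x \in _); last by rewrite mulr_ge0// expR_ge0.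
  have /= vV := set_mem xA; rewrite -expRD; apply: le_trans (expR_ge1Dx _).
  by rewrite lerDl addrC subr_ge0 ler_pM2l// ltW.
set G := [set t | _ <= _].
have mSX := measurable_sumw X mX.
have mU1 : measurable U1.
  by apply: measurable_superlevel; apply: (measurable_sumw (fun x => l * Y x)); exact: measurable_funM.
have mU2 : measurable U2.
  by apply: measurable_superlevel; apply: (measurable_sumw (fun x => - l * X x)); exact: measurable_funM.
have mG : measurable G.
  rewrite (_ : G = ~` [set t | eps * (D%:R * mu) < `|\sum_(j < D) X (w j t) - D%:R * mu|]).
    apply: measurableC; apply: measurable_superlevel.
    by apply: measurableT_comp => //; exact: measurable_funB.
  by apply/seteqP; split => t /=; rewrite /G/= leNgt => /negP.
have intU3 : P.-integrable setT (EFin \o (fun t => \sum_(j < D) (\1_[set x | v < V x] (w j t) : R))).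
  apply: integrable_Rsum => j.
  rewrite (_ : (fun t => _) = \1_(w j @^-1` [set x | v < V x])).
    by apply: integrable_indic; rewrite -[X in measurable X]setTI; exact: mw.
  by apply/funext => t; rewrite !indicE.
have i1 := integrable_indic _ _ P U1 mU1; have i2 := integrable_indic _ _ P U2 mU2.
have int1 : P.-integrable setT (EFin \o (fun=> 1 : R)).
  by apply: (@integrable_bounded _ _ _ _ _ `|1|).
have i12 := integrable_EFinB _ _ _ (integrable_EFinB _ _ _ int1 i1) i2.
have i3 := integrable_EFinB _ _ _ i12 intU3.
(* The union bound in integrated form: pointwise, the indicator of [G] is at least 1 minus those of
   the two tails and the number of samples beyond [v]. *)
apply: (@le_trans _ _ (\int[P]_t (1 - \1_U1 t - \1_U2 t - \sum_(j < D) \1_[set x | v < V x] (w j t)))).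
  rewrite RintegralB// RintegralB//; last exact: integrable_EFinB.
  by rewrite RintegralB// Rintegral_prob_cst; lra.
apply: le_Rintegral => //; first exact: integrable_indic.
move=> t _.
have i0 d0 (U : measurableType d0) (A : set U) x : 0 <= \1_A x :> R by rewrite indicE ler0n.
have s0 : 0 <= \sum_(j < D) \1_[set x | v < V x] (w j t) :> R by apply: sumr_ge0.
have [/existsP[j jV]|/existsPn jV] := boolP [exists j, v < V (w j t)].
  have s1 : 1 <= \sum_(j < D) \1_[set x | v < V x] (w j t) :> R.
    rewrite (bigD1 j)//= indicE mem_set// lerDl; exact: sumr_ge0.
  by have := i0 _ _ U1 t; have := i0 _ _ U2 t; have := i0 _ _ G t; lra.
have YXt : \sum_(j < D) (l * Y (w j t)) = l * \sum_(j < D) X (w j t).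
  rewrite -mulr_sumr; congr (_ * _); apply: eq_bigr => j _.
  by rewrite /Y indicE mem_set ?mulr1//=; apply/negP; exact: jV.
have [t1|t1] := boolP (t \in U1).
  by rewrite [\1_U1 t]indicE t1 -[true%:R]/(1 : R); have := i0 _ _ U2 t; have := i0 _ _ G t; lra.
have [t2|t2] := boolP (t \in U2).
  by rewrite [\1_U2 t]indicE t2 -[true%:R]/(1 : R); have := i0 _ _ U1 t; have := i0 _ _ G t; lra.
suff tG : G t by rewrite [\1_G t]indicE mem_set// -[true%:R]/(1 : R); have := i0 _ _ U1 t; have := i0 _ _ U2 t; lra.
move: t1 t2; rewrite !notin_setE /U1 /U2 /= => /negP + /negP; rewrite -!leNgt YXt -mulr_sumr.
rewrite ler_pM2l// !mulNr lerN2 ler_pM2l// => h1 h2.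
rewrite /G/= ler_norml; apply/andP; split; lra.
Qed.

End Concentration.

(** * Solving for the sample size *)

Lemma expR1_le4 {R : realType} : expR 1 <= 4 :> R.
Proof.
have h := expR_ge1Dx (- (1 / 2) : R).
have h2 : expR (1 / 2) <= 2 :> R.
  rewrite -[1 / 2]opprK expRN -[leRHS]invrK lef_pV2 ?posrE ?expR_gt0 ?invr_gt0//.
  by apply: le_trans h; lra.
have -> : (1 : R) = 1 / 2 + 1 / 2 by field.
rewrite expRD; have := expR_ge0 (1 / 2 : R); nra.
Qed.

Lemma ln_inv_ge1 {R : realType} (delta : R) : 0 < delta -> delta <= 1 / 4 -> 1 <= ln delta^-1.
Proof.
move=> d0 d4; rewrite -ler_expR lnK ?posrE ?invr_gt0//.
apply: (le_trans expR1_le4); rewrite -[4]invrK lef_pV2 ?posrE ?invr_gt0//.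
by apply: (le_trans d4); lra.
Qed.

(** The cut-off [v = ln (3 B D / delta) / t0] depends on [D], so the requirement on [D] is implicit.
    Let [y = ln D] and [L = ln (1 / delta)]. If [y <= 4 L], then [v] is of order [L] and
    [eps^-1 L^3] samples suffice. Otherwise [eps^-1 <= delta^-1 <= D^(1/4)], [y^3 <= 216 D^(1/2)]
    and the constants are at most [D^(1/4)], so the product stays below [D]. *)
Lemma sample_size_bound {R : realType} (C0 t0 B : R) : 0 < C0 -> 0 < t0 -> 1 <= B ->
  exists C1 : R, 0 < C1 /\ forall (eps delta : R) (D : nat),
    0 < delta -> delta <= eps -> eps <= 1 / 4 ->
    C1 * eps^-1 * (ln delta^-1) ^+ 3 <= D%:R ->
    0 < D%:R :> R /\ 0 <= ln (3 * B * D%:R / delta) / t0 /\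
    12 * C0 * eps^-1 * ln delta^-1 * (ln (3 * B * D%:R / delta) / t0) ^+ 2 <= D%:R.
Proof.
move=> C00 t00 B1.
pose b := ln (3 * B); have b0 : 0 <= b by rewrite ln_ge0//; lra.
pose k := 12 * C0 / t0 ^+ 2; have k0 : 0 < k by rewrite divr_gt0 ?exprn_gt0// mulr_gt0.
(* [54 = 216 / 4], with 216 from the bound on [y ^+ 3] and 4 from [L <= y / 4]; the summand [M ^+ 4]
   of [C1] yields [M <= D^(1/4)]. *)
pose M := 54 * k * (b + 2) ^+ 2.
have b2 : 0 < b + 2 by lra.
have b5 : 0 < b + 5 by lra.
have M0 : 0 < M by apply: mulr_gt0; [exact: mulr_gt0|exact: exprn_gt0].
pose C1 := k * (b + 5) ^+ 2 + M ^+ 4.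
have C10 : 0 < C1 by apply: addr_gt0; [apply: mulr_gt0 => //; exact: exprn_gt0|exact: exprn_gt0].
exists C1; split => // eps delta D d0 de e4 hD.
have e0 : 0 < eps by exact: lt_le_trans de.
pose L := ln delta^-1; have L1 : 1 <= L by apply: ln_inv_ge1 => //; exact: le_trans e4.
have L0 : 0 < L by lra.
have ei0 : 0 < eps^-1 by rewrite invr_gt0.
have ei1 : 1 <= eps^-1 by rewrite -[1]invr1 lef_pV2 ?posrE//; lra.
have L3 : 1 <= L ^+ 3 by rewrite exprn_ege1.
have C1D : C1 <= D%:R.
  apply: le_trans hD; rewrite -mulrA ler_peMr ?(ltW C10)//.
  by rewrite -[1]mulr1; apply: ler_pM.
have D0 : 0 < D%:R :> R by exact: lt_le_trans C1D.
have D1 : 1 <= D%:R :> R by rewrite ler1n -(ltr0n R).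
pose y := ln (D%:R : R).
have y0 : 0 <= y by rewrite ln_ge0.
have Dy : D%:R = expR y :> R by rewrite lnK.
have vE : ln (3 * B * D%:R / delta) = b + y + L.
  have B0 : 0 < B by lra.
  have B30 : 0 < 3 * B by exact: mulr_gt0.
  rewrite lnM ?posrE ?invr_gt0 ?(mulr_gt0 B30)//.
  by rewrite [ln (3 * B * _)]lnM ?posrE.
rewrite vE; split => //; split; first by rewrite divr_ge0 ?(ltW t00)//; lra.
have -> : 12 * C0 * eps^-1 * L * ((b + y + L) / t0) ^+ 2 = k * (b + y + L) ^+ 2 * (eps^-1 * L).
  by rewrite /k; field; rewrite !gt_eqF.
have eL0 : 0 <= eps^-1 * L by rewrite mulr_ge0 ?(ltW ei0) ?(ltW L0).
have [yL|Ly] := leP y (4 * L).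
  apply: le_trans hD.
  apply: (@le_trans _ _ (k * (b + 5) ^+ 2 * L ^+ 2 * (eps^-1 * L))).
    apply: ler_wpM2r => //; rewrite -mulrA; apply: ler_wpM2l; first exact: ltW.
    rewrite -exprMn; apply: lerXn2r; rewrite ?nnegrE; [lra|by rewrite mulr_ge0 ?(ltW b5) ?(ltW L0)|].
    have : b <= b * L by rewrite ler_peMr. 
    by nra.
  have -> : k * (b + 5) ^+ 2 * L ^+ 2 * (eps^-1 * L) = (k * (b + 5) ^+ 2) * (eps^-1 * L ^+ 3) by ring.
  rewrite -[leRHS]mulrA; apply: ler_wpM2r; first by rewrite mulr_ge0 ?(ltW ei0) ?exprn_ge0 ?(ltW L0).
  by rewrite /C1 lerDl exprn_ge0 ?(ltW M0).
have y4 : 4 <= y by lra.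
have ey : eps^-1 <= expR (y / 4).
  apply: (@le_trans _ _ delta^-1); first by rewrite lef_pV2.
  have -> : delta^-1 = expR L by rewrite lnK ?posrE ?invr_gt0.
  by rewrite ler_expR; lra.
have y3 : y ^+ 3 <= 216 * expR (y / 2).
  have h : y / 6 <= expR (y / 6) by apply: le_trans (expR_ge1Dx _); lra.
  have -> : expR (y / 2) = expR (y / 6) ^+ 3 by rewrite -expRM_natr; congr expR; field.
  have -> : y ^+ 3 = 216 * (y / 6) ^+ 3 by field.
  by apply: ler_wpM2l => //; apply: lerXn2r; rewrite ?nnegrE ?expR_ge0//; lra.
have MD : M <= expR (y / 4).
  have : M ^+ 4 <= expR (y / 4) ^+ 4.
    have -> : expR (y / 4) ^+ 4 = D%:R by rewrite Dy -expRM_natr; congr expR; field.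
    apply: le_trans C1D; rewrite /C1 lerDr mulr_ge0 ?(ltW k0)//; exact: sqr_ge0.
  by rewrite ler_pXn2r ?nnegrE ?expR_ge0 ?(ltW M0).
have byL : b + y + L <= (b + 2) * y.
  have : b <= b * y by rewrite ler_peMr//; lra.
  by lra.
apply: (@le_trans _ _ (k * ((b + 2) * y) ^+ 2 * (expR (y / 4) * (y / 4)))).
  apply: ler_pM => //.
  - by rewrite mulr_ge0 ?(ltW k0) ?sqr_ge0.
  - apply: ler_wpM2l; first exact: ltW.
    by apply: lerXn2r; rewrite ?nnegrE//; [lra|rewrite mulr_ge0 ?(ltW b2)].
  by apply: ler_pM => //; [exact: ltW|exact: ltW|lra].
have -> : k * ((b + 2) * y) ^+ 2 * (expR (y / 4) * (y / 4)) =
    (k * (b + 2) ^+ 2 / 4 * expR (y / 4)) * y ^+ 3 by field.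
have c0 : 0 <= k * (b + 2) ^+ 2 / 4 * expR (y / 4).
  by rewrite mulr_ge0 ?expR_ge0// divr_ge0// mulr_ge0 ?(ltW k0) ?sqr_ge0.
apply: (le_trans (ler_wpM2l c0 y3)).
have -> : k * (b + 2) ^+ 2 / 4 * expR (y / 4) * (216 * expR (y / 2)) = M * (expR (y / 4) * expR (y / 2)).
  by rewrite /M; field.
have -> : D%:R = expR (y / 4) * (expR (y / 4) * expR (y / 2)).
  by rewrite Dy -!expRD; congr expR; field.
by apply: ler_wpM2r => //; rewrite mulr_ge0 ?expR_ge0.
Qed.

(** * Distances in terms of 1 - cos *)

Section Distances.
Context {R : realType} {d : nat}.
Implicit Types x y w : d.-tuple R.

Lemma dotp_vsub w x y : dotp w (vsub x y) = dotp w x - dotp w y.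
Proof.
rewrite /dotp -sumrB; apply: eq_bigr => i _.
by rewrite tnth_mktuple mulrBr.
Qed.

Lemma dist_rffE (D : nat) (w : 'I_D -> d.-tuple R) x y :
  dist_rff w x y = Num.sqrt (2 / D%:R * \sum_(j < D) (1 - cos (dotp (w j) (vsub x y)))).
Proof.
rewrite /dist_rff mulr_sumr; congr Num.sqrt; apply: eq_bigr => j _.
rewrite big_bool/= /rff -!mulrBr !exprMn sqr_sqrtr ?invr_ge0//.
rewrite dotp_vsub cosB -mulrDr -[2 / _]mulrC -mulrA; congr (_ * _).
set a := dotp _ x; set b := dotp _ y.
rewrite !sqrrB; have := cos2Dsin2 a; have := cos2Dsin2 b; lra.
Qed.

End Distances.

(** [|a - b|] is [|sqrt a - sqrt b|] times [sqrt a + sqrt b], and the last factor is at least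
    [sqrt b]. *)
Lemma sqrt_relative_error {R : realType} (a b eps : R) : 0 <= a -> 0 < b ->
  `|a - b| <= eps * b -> `|Num.sqrt a - Num.sqrt b| <= eps * Num.sqrt b.
Proof.
move=> a0 b0 h; have sb : 0 < Num.sqrt b by rewrite sqrtr_gt0.
have sa : 0 <= Num.sqrt a by exact: sqrtr_ge0.
rewrite -(ler_pM2r sb).
have -> : eps * Num.sqrt b * Num.sqrt b = eps * b by rewrite -mulrA -expr2 sqr_sqrtr// ltW.
apply: le_trans h.
have -> : `|a - b| = `|Num.sqrt a - Num.sqrt b| * (Num.sqrt a + Num.sqrt b).
  rewrite -[X in _ * X]ger0_norm; last by rewrite addr_ge0// ltW.
  by rewrite -normrM -subr_sqr !sqr_sqrtr// ltW.
by apply: ler_wpM2l => //; rewrite lerDr.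
Qed.

(** * Restriction to the axes and assembly *)

(** On the [i]-th axis every monomial with a positive exponent off [i] vanishes, so one multi-index
    per degree is left. Degrees up to [N] make [N.+1] terms. *)
Lemma axis_power_series {R : realType} {d : nat} (c : ('I_d -> nat) -> R) (i : 'I_d) (s : R) (N : nat) :
  pseries_partial c [tuple of nseq d 0] [tuple (if j == i then s else 0) | j < d] id N =
  series (fun m => c (fun j => if j == i then m else 0%N) * s ^+ m) N.+1.
Proof.
rewrite /pseries_partial /series/= big_mkord.
rewrite (partition_big (fun al : {ffun 'I_d -> 'I_N.+1} => al i) predT)//=.
apply: eq_bigr => m _.
pose am : {ffun 'I_d -> 'I_N.+1} := [ffun j => if j == i then m else ord0].
have amE j : am j = (if j == i then m : nat else 0%N) :> nat.
  by rewrite ffunE; case: ifP.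
rewrite (bigD1 am)/=; last first.
  have -> : am i == m by rewrite ffunE eqxx.
  rewrite andbT (bigD1 i)//= amE eqxx big1 => [|j ji]; first by rewrite addn0 -ltnS ltn_ord.
  by rewrite amE (negbTE ji).
rewrite [X in _ + X]big1 ?addr0; last first.
  move=> al /andP[/andP[_ /eqP ali] neq].
  have [j ji alj] : exists2 j, j != i & al j != ord0.
    apply: contrapT => h; move/eqP: neq; apply; apply/ffunP => j; rewrite ffunE.
    case: eqVneq => [->//|ji]; apply/eqP; apply: contrapT => alj.
    by apply: h; exists j => //; apply/negP.
  rewrite (bigD1 j)//= tnth_mktuple tnth_nseq (negbTE ji) subr0 expr0n.
  by rewrite (_ : (al j == 0%N :> nat) = false) ?mul0r ?mulr0//; apply/negbTE.
congr (_ * _); first by congr c; apply/funext => j; exact: amE.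
rewrite (bigD1 i)//= big1 ?mulr1 => [|j ji].
  by rewrite tnth_mktuple tnth_nseq amE eqxx subr0.
by rewrite amE (negbTE ji) expr0.
Qed.

(** Some coordinate carries at least the share [1 / d.+1] of [norm1 w]; otherwise summing over the
    coordinates forces [norm1 w <= 0]. The divisor [d.+1] stays positive for [d = 0]. *)
Lemma expR_norm1_le {R : realType} {d : nat} (t : R) (w : d.-tuple R) : 0 <= t ->
  expR (t / d.+1%:R * (1 + norm1 w)) <=
  expR (t / d.+1%:R) * (1 + \sum_(i < d) expR (t * `|tnth w i|)).
Proof.
move=> t0; rewrite mulrDr mulr1 expRD ler_wpM2l ?expR_ge0//.
have d0 : 0 < d.+1%:R :> R by rewrite ltr0n.
have s0 : 0 <= \sum_(i < d) expR (t * `|tnth w i|) by apply: sumr_ge0 => i _; exact: expR_ge0.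
have [[i hi]|/forallNP h] := pselect (exists i, norm1 w <= d.+1%:R * `|tnth w i|).
  apply: (@le_trans _ _ (expR (t * `|tnth w i|))).
    rewrite ler_expR mulrAC ler_pdivrMr// -mulrA; apply: ler_wpM2l => //.
    by rewrite mulrC.
  rewrite (bigD1 i)//= addrCA lerDl addr_ge0//.
  by apply: sumr_ge0 => j _; exact: expR_ge0.
have n0 : norm1 w <= 0.
  have : d.+1%:R * norm1 w <= d%:R * norm1 w.
    apply: (@le_trans _ _ (\sum_(i < d) norm1 w)); last by rewrite sumr_const card_ord mulr_natl.
    rewrite {1}/norm1 mulr_sumr.
    by apply: ler_sum => i _; have /negP := h i; rewrite -ltNge => /ltW.
  by rewrite -natr1 mulrDl mul1r; lra.
apply: (@le_trans _ _ 1); last by rewrite lerDl.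
by rewrite expR_le1 mulr_ge0_le0// divr_ge0// ltW.
Qed.

Theorem theorem1p2 (R : realType) (d : nat) (K p : d.-tuple R -> R) :
  K [tuple of nseq d 0] = 1 ->
  analytic_at_origin K ->
  bochner_density K p ->
  exists C1 C2 : R, 0 < C1 /\ 0 < C2 /\
  forall (eps delta : R) (D : nat),
    0 < delta -> delta <= eps -> eps <= (2 ^+ 16)^-1 ->
    C1 * eps^-1 * (ln delta^-1) ^+ 3 <= D%:R ->
    C2 * eps^-2 * ln delta^-1 <= D%:R ->
    forall (dsp : measure_display) (Omega : measurableType dsp)
           (P : probability Omega R) (w : 'I_D -> Omega -> d.-tuple R),
    iid_density P p w ->
    forall x y : d.-tuple R,
      ((1 - delta)%:E <=
       P [set t | (`|dist_rff (fun j => w j t) x y - dist_phi K x y|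
                  <= eps * dist_phi K x y)%R])%E.
Proof.
move=> _ [r [r0 anK]] boch; have [[mp [p0 _]] _] := boch.
have [mu [Q [QA QK Hint Hge0 Qp]]] := bochner_law K p boch.
have [|c [rho [rho0 cvgK]]] := anK [tuple of nseq d 0].
  by rewrite /= /norm1 big1// => i _; rewrite tnth_nseq normr0.
have mtnth i : measurable_fun [set: d.-tuple R] (fun w : d.-tuple R => tnth w i).
  exact: measurable_tnth.
(* On the [i]-th axis [K] is the expectation of [cos (s w_i)], and its expansion is a power series
   in [s] alone. *)
have expmom i : (\int[Q]_w (expR (rho / 16 * `|tnth w i|))%:E < +oo)%E.
  apply: (exponential_moment Q _ (mtnth i) (fun m => c (fun j => if j == i then m else 0%N)) rho rho0).
  move=> s srho; pose x := [tuple (if j == i then s else 0) | j < d].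
  have -> : \int[Q]_w cos (s * tnth w i) = K x.
    rewrite -QK; apply: eq_Rintegral => w _; congr cos.
    rewrite /dotp (bigD1 i)//= big1 => [|j ji]; rewrite tnth_mktuple.
      by rewrite eqxx addr0 mulrC.
    by rewrite (negbTE ji) mulr0.
  have [|_ cvx] := cvgK x.
    by move=> j; rewrite tnth_mktuple tnth_nseq subr0; case: ifP => // _; rewrite normr0.
  rewrite -cvg_shiftS; apply: cvg_trans cvx; apply: near_eq_cvg; apply: nearW => N.
  exact: axis_power_series.
pose t0 := rho / 16 / d.+1%:R; have t00 : 0 < t0 by rewrite !divr_gt0// ltr0n.
have mnorm1 : measurable_fun [set: d.-tuple R] (@norm1 R d).
  by rewrite /norm1; apply: measurable_sum => i; exact: measurableT_comp.
pose V (w : d.-tuple R) := 1 + norm1 w.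
have mV : measurable_fun [set: d.-tuple R] V by exact: measurable_funD.
have V1 w : 1 <= V w by rewrite lerDl; exact: sumr_ge0.
have inte i : Q.-integrable [set: d.-tuple R] (EFin \o (fun w => expR (rho / 16 * `|tnth w i|))).
  apply/integrableP; split.
    apply/measurable_EFinP; apply: measurableT_comp => //; apply: measurable_funM => //.
    exact: measurableT_comp.
  by under eq_integral do rewrite /= ger0_norm ?expR_ge0//.
have intV : Q.-integrable [set: d.-tuple R] (EFin \o (fun w => expR (t0 * V w))).
  have int1 : Q.-integrable [set: d.-tuple R] (EFin \o (fun=> 1 : R)).
    by apply: (@integrable_bounded _ _ _ _ _ `|1|).
  apply: (le_integrable measurableT _ _ (integrable_EFinZl Q (expR t0) _
    (integrable_EFinD Q _ _ int1 (integrable_Rsum Q _ (index_enum 'I_d) _ inte)))).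
    by apply/measurable_EFinP; apply: measurableT_comp => //; exact: measurable_funM.
  move=> w _ /=; rewrite lee_fin ger0_norm ?expR_ge0//.
  apply: le_trans (ler_norm _); apply: expR_norm1_le.
  by rewrite divr_ge0// ltW.
(* The added 1 gives [1 <= B], as the sample-size bound requires. *)
pose B := 1 + \int[Q]_w expR (t0 * V w).
have B1 : 1 <= B by rewrite lerDl; apply: Rintegral_ge0 => w _; exact: expR_ge0.
have EV : \int[Q]_w expR (t0 * V w) <= B by rewrite /B lerDr.
have [C0 [C00 hC0]] := one_sub_cos_dominated mu Q p Hint Hge0 Qp mp p0.
have [C1 [C10 hC1]] := sample_size_bound C0 t0 B C00 t00 B1.
pose C2 := C0 ^+ 2 * (4 / t0) ^+ 4 * B.
have B0 : 0 < B by exact: lt_le_trans B1.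
have C20 : 0 < C2.
  by apply: mulr_gt0 => //; apply: mulr_gt0; apply: exprn_gt0 => //; exact: divr_gt0.
(* [24 = 8 * 3]: 8 from solving [D theta eps / 2 >= ln (3 / delta)] with [theta = eps / (4 C2)], and
   3 from [ln (3 / delta) <= 3 ln (1 / delta)]. *)
exists C1, (24 * C2); split => //; split; first exact: mulr_gt0.
move=> eps delta D delta0 de e16 hD1 hD2 dsp Omega P w [mw [lawP indepP]] x y.
have eps4 : eps <= 1 / 4.
  by apply: (le_trans e16); rewrite mul1r lef_pV2 ?posrE// -natrX ler_nat.
have eps0 : 0 < eps by exact: lt_le_trans de.
have [D0 [v0 hv]] := hC1 eps delta D delta0 de eps4 hD1.
set v := ln (3 * B * D%:R / delta) / t0 in v0 hv.
pose z := vsub x y; pose X (u : d.-tuple R) := 1 - cos (dotp u z).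
have mX : measurable_fun [set: d.-tuple R] X by apply: measurable_funB => //; exact: measurable_cos_dotp.
have X02 u : 0 <= X u <= 2 by exact: one_sub_cos_itv.
have EX : \int[Q]_u X u = 1 - K z.
  rewrite RintegralB// ?Rintegral_prob_cst ?QK//.
    by apply: (@integrable_bounded _ _ _ _ _ `|1|).
  apply: (@integrable_bounded _ _ _ _ _ 1); first exact: measurable_cos_dotp.
  by move=> u; exact: normr_cos_le1.
have distphi : dist_phi K x y = Num.sqrt (2 * \int[Q]_u X u).
  by rewrite EX /dist_phi; congr Num.sqrt; rewrite -/z; ring.
have EX0 : 0 <= \int[Q]_u X u by apply: Rintegral_ge0 => u _; case/andP: (X02 u).
set E := [set t | _].
(* If the mean is zero, the domination makes [X] vanish everywhere; both distances are then zero and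
   the event is certain. *)
have [mu_gt0|] := ltP 0 (\int[Q]_u X u); last first.
  move=> mu_le0; have mu_eq0 : \int[Q]_u X u = 0 by apply/eqP; rewrite eq_le mu_le0.
  have Xeq0 u : X u = 0.
    apply/eqP; rewrite eq_le; have /andP[-> _] := X02 u; rewrite andbT.
    by have := hC0 z u; rewrite -/(X u) mu_eq0 mulr0.
  have -> : E = setT.
    apply/seteqP; split => // t _; rewrite /E/= distphi mu_eq0 mulr0 dist_rffE.
    rewrite big1 => [|j _]; last exact: Xeq0.
    by rewrite mulr0 sqrtr0 subrr normr0 mulr0.
  by rewrite probability_setT lee_fin; lra.
(* The largest value that the second moment and the cut-off allow; each entry is matched by one of
   the two conditions on [D]. *)
pose theta := Num.min (eps / (4 * C2)) (1 / (2 * C0 * v ^+ 2)).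
have v_gt0 : 0 < v.
  rewrite divr_gt0// ln_gt0// ltr_pdivlMr// mul1r.
  have D1 : 1 <= D%:R :> R by rewrite ler1n -(ltr0n R).
  have : 1 <= B * D%:R by rewrite -[leLHS]mulr1; apply: ler_pM.
  rewrite -mulrA => ?; lra.
have theta0 : 0 < theta.
  rewrite lt_min; apply/andP; split; apply: divr_gt0 => //; first exact: mulr_gt0.
  by apply: mulr_gt0; [exact: mulr_gt0|exact: exprn_gt0].
have L1 : 1 <= ln delta^-1 by apply: ln_inv_ge1 => //; exact: le_trans eps4.
have ln3 : ln (3 / delta) <= 3 * ln delta^-1.
  have l3 : ln (3 : R) <= 2.
    by rewrite -[leRHS]expRK ler_ln ?posrE ?expR_gt0//; apply: le_trans (expR_ge1Dx _); lra.
  by rewrite lnM ?posrE ?invr_gt0//; lra.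
have G := @iid_concentration R _ _ Omega _ P Q D w mw _ indepP X V mX mV X02 V1 C0 t0 B C00 t00
  intV EV mu_gt0 (hC0 z) eps delta theta v eps0 delta0 theta0 _ _ v0 _ _.
have {}G : 1 - delta <= \int[P]_t \1_[set t | `|\sum_(j < D) X (w j t) - D%:R * \int[Q]_u X u| <=
    eps * (D%:R * \int[Q]_u X u)] t.
  apply: G.
  - by move=> j A mA; rewrite lawP// QA.
  - have C24 : 0 < 4 * C2 by exact: mulr_gt0.
    have : theta <= eps / (4 * C2) by rewrite /theta ge_min lexx.
    by rewrite ler_pdivlMr.
  - apply: (@le_trans _ _ (1 / (2 * C0 * v ^+ 2) * (C0 * v ^+ 2))).
      by apply: ler_wpM2r; [rewrite mulr_ge0 ?(ltW C00) ?sqr_ge0|rewrite /theta ge_min lexx orbT].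
    by rewrite le_eqVlt; apply/orP; left; apply/eqP; field; rewrite !gt_eqF.
  - apply: (le_trans ln3).
    have [->|->] : theta = eps / (4 * C2) \/ theta = 1 / (2 * C0 * v ^+ 2).
      by rewrite /theta minElt; case: ifP => _; [left|right].
      have -> : D%:R * (eps / (4 * C2) * eps / 2) = D%:R * eps ^+ 2 / (8 * C2) by field; rewrite gt_eqF.
      have C28 : 0 < 8 * C2 by exact: mulr_gt0.
      have eps2 : 0 < eps ^+ 2 by exact: exprn_gt0.
      rewrite ler_pdivlMr// -(ler_pdivrMr _ _ eps2).
      apply: le_trans hD2; rewrite le_eqVlt; apply/orP; left; apply/eqP.
      by field; rewrite gt_eqF.
    have -> : D%:R * (1 / (2 * C0 * v ^+ 2) * eps / 2) = D%:R * eps / (4 * C0 * v ^+ 2).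
      by field; rewrite !gt_eqF.
    have den0 : 0 < 4 * C0 * v ^+ 2 by apply: mulr_gt0; [exact: mulr_gt0|exact: exprn_gt0].
    rewrite ler_pdivlMr// -(ler_pdivrMr _ _ eps0).
    apply: le_trans hv; rewrite le_eqVlt; apply/orP; left; apply/eqP.
    by field; rewrite gt_eqF.
  (* [v] is chosen so that [D B exp (- t0 v)] equals [delta / 3]. *)
  - have -> : t0 * v = ln (3 * B * D%:R / delta) by rewrite /v mulrC divfK// gt_eqF.
    rewrite expRN lnK ?posrE ?divr_gt0 ?mulr_gt0//.
    by rewrite le_eqVlt; apply/orP; left; apply/eqP; field; rewrite !gt_eqF.
set A := [set t | _] in G.
have mS : measurable_fun [set: Omega] (fun t => \sum_(j < D) X (w j t)).
  by apply: measurable_sum => j; exact: measurableT_comp.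
have mA : measurable A.
  rewrite (_ : A = ~` [set t | eps * (D%:R * \int[Q]_u X u) < `|\sum_(j < D) X (w j t) - D%:R * \int[Q]_u X u|]).
    apply: measurableC; apply: measurable_superlevel.
    by apply: measurableT_comp => //; exact: measurable_funB.
  by apply/seteqP; split => t /=; rewrite /A/= leNgt => /negP.
have mE : measurable E.
  rewrite (_ : E = ~` [set t | eps * dist_phi K x y < `|dist_rff (fun j => w j t) x y - dist_phi K x y|]).
    apply: measurableC; apply: measurable_superlevel.
    apply: measurableT_comp => //; apply: measurable_funB => //.
    under eq_fun do rewrite dist_rffE.
    have msqrt : measurable_fun setT (@Num.sqrt R).
      by apply: continuous_measurable_fun; exact: sqrt_continuous.
    by apply: (measurableT_comp msqrt); exact: measurable_funM.
  by apply/seteqP; split => t /=; rewrite /E/= leNgt => /negP.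
have AE : A `<=` E.
  move=> t; rewrite /A/E/= => h; rewrite distphi dist_rffE.
  apply: sqrt_relative_error.
  - apply: mulr_ge0; first by rewrite divr_ge0.
    by apply: sumr_ge0 => j _; case/andP: (X02 (w j t)).
  - exact: mulr_gt0.
  have -> : 2 / D%:R * \sum_(j < D) (1 - cos (dotp (w j t) (vsub x y))) - 2 * \int[Q]_u X u =
      2 / D%:R * (\sum_(j < D) X (w j t) - D%:R * \int[Q]_u X u).
    by rewrite mulrBr mulrA divfK ?gt_eqF.
  rewrite normrM ger0_norm ?divr_ge0//.
  have c0 : 0 <= 2 / D%:R :> R by rewrite divr_ge0.
  apply: (le_trans (ler_wpM2l c0 h)).
  by rewrite le_eqVlt; apply/orP; left; apply/eqP; field; rewrite gt_eqF.
apply: (@le_trans _ _ (P A)); last by apply: le_measure => //; rewrite inE.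
by move: G; rewrite Rintegral_indic// -lee_fin fineK// fin_num_measure.
Qed.
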